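(* Let $G$ be a finite simple cubic graph that contains no cycle of length $4$. Then $i(G) \le \frac{5}{14}|V(G)|$.
   Context: A dominating set of a graph $G$ is a set $S\subseteq V(G)$ such that every vertex not in $S$ has a neighbor in $S$. The independent domination number $i(G)$ is the minimum size of a dominating set of $G$ that is also an independent set. A graph is cubic if every vertex has degree $3$. ''Contains no cycle of length $4$'' means no $4$-cycle as a subgraph (not necessarily induced). *)

(* Defs.v *)
From mathcomp Require Import all_boot all_order all_algebra.

Set Implicit Arguments.
Unset Strict Implicit.
Unset Printing Implicit Defensive.

Record sgraph := SGraph {
  vertex :> finType;
  adj : rel vertex;
  adj_sym : symmetric adj;
  adj_irrefl : irreflexive adj }.

Section SGraphDefs.
Variable G : sgraph.
Implicit Types (v w : G) (S : {set G}).

Definition degree v : nat := #|[set w | adj v w]|.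

Definition cubic : Prop := forall v, degree v = 3.

(* [ucycle] allows sequences of size at most 2, hence the bound on [k]:
   below 3 this would not be the existence of a graph cycle. *)
Definition has_cycle_of_length (k : nat) : Prop :=
  2 < k /\ exists2 c : seq G, ucycle (@adj G) c & size c = k.

Definition dominating S : bool :=
  [forall v, (v \notin S) ==> [exists w in S, adj v w]].

Definition independent S : bool :=
  [forall v in S, forall w in S, ~~ adj v w].

Definition independent_dominating S : bool := independent S && dominating S.

(* A maximal independent set is dominating, so the minimum defining
   [indep_dom_num] is taken over a nonempty family. *)
Lemma ex_independent_dominating :
  exists n, [exists S : {set G}, independent_dominating S && (#|S| == n)].
Proof.
have ind0 : independent (set0 : {set G}).
  by apply/forall_inP => v; rewrite inE.
have [S /maxsetP[indS maxS] _] := maxset_exists ind0.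
exists #|S|; apply/existsP; exists S; rewrite eqxx andbT /independent_dominating.
rewrite indS; apply/forallP => v; apply/implyP => vS.
apply: contraT; rewrite negb_exists_in => /forall_inP nadj.
suff indvS : independent (v |: S).
  by rewrite -(maxS _ indvS (subsetUr _ _)) setU11 in vS.
apply/forall_inP => x; rewrite in_setU1 => /orP[/eqP->|xS];
  apply/forall_inP => y; rewrite in_setU1 => /orP[/eqP->|yS].
- by rewrite adj_irrefl.
- exact: nadj.
- by rewrite adj_sym nadj.
- by move/forall_inP: indS => /(_ x xS)/forall_inP/(_ y yS).
Qed.

Definition indep_dom_num : nat := ex_minn ex_independent_dominating.

End SGraphDefs.

(* Main.v *)
(* The bound is proved for all graphs with maximum degree at most 3 and no
   4-cycle in the weighted form 14 i(G) <= 14 n0 + 9 n1 + 6 n2 + 5 n3, where nk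
   counts the vertices of degree k. Consider a minimal counterexample. Deleting
   the closed neighbourhood A of an independent set S must lower the weight by
   less than 14 |S|: the vertices of A contribute their weights, and a vertex
   outside A that loses edges gains weight. For a vertex whose second
   neighbourhood is cubic the balance is 4 * 5 - 6 = 14, as no outside vertex
   loses two edges by the absence of 4-cycles; so a counterexample needs vertices
   of low degree almost everywhere, and a finite case analysis finds a set S that
   can be deleted near each of them. Chains of cubic vertices that each carry a
   leaf, and chains through pentagons with three vertices of degree 2, are tight
   at every length; they are shortened instead by a deletion that adds an edge. *)
Require Import Defs.
From mathcomp Require Import all_boot all_order all_algebra.
From mathcomp Require Import zify.
Import Order.TTheory GRing.Theory Num.Theory.

Set Implicit Arguments.
Unset Strict Implicit.
Unset Printing Implicit Defensive.

Local Open Scope nat_scope.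

(** * Minimal counterexamples *)

(** Deleting closed neighbourhoods leaves the class of cubic graphs, so the induction needs a weight
    for every degree up to 3. An isolated vertex must be chosen, hence 14; a cubic vertex must weigh
    5 for the ratio 5/14. The drops between consecutive weights are 5, 3, 1. The last makes an edge
    lost by a cubic vertex cost only 1, the first bounds the cost of any lost edge, and their
    decrease (convexity) allows a vertex of unknown degree to be charged as if it had only its known
    neighbours. Both shortenings then pay exactly: a cubic vertex and its leaf weigh 5 + 9 = 14; at
    the pentagon 6 + 6 + 5 is deleted while one vertex rises from 6 to 9, again 14 net. The case
    analysis is a computation on partial graphs: a boolean function, proved sound once, checks trees
    of choices, and refuted configurations serve as lemmas for later trees. It ends with the
    one-vertex graphs of degree 1, 2 and 3, whose refutation leaves no vertex at all. *)

Definition wt (d : nat) : nat :=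
  match d with 0 => 14 | 1 => 9 | 2 => 6 | _ => 5 end.

Section InducedSubgraphs.
Variable T : finType.
Implicit Types (e : rel T) (X Y I S : {set T}) (u v w : T).

Definition nbrs e X v : {set T} := [set u in X | e v u].
Definition deg e X v : nat := #|nbrs e X v|.
Definition weight e X : nat := \sum_(v in X) wt (deg e X v).

Definition light_ids e X : bool :=
  [exists I : {set T}, [&& I \subset X,
     [forall u in I, forall v in I, ~~ e u v],
     [forall v in X :\: I, exists u in I, e v u] &
     14 * #|I| <= weight e X]].

Record admissible e X : Prop := Admissible {
  adm_sym : symmetric e;
  adm_irr : irreflexive e;
  adm_deg : {in X, forall v, deg e X v <= 3};
  adm_C4 : forall a b c d, a \in X -> b \in X -> c \in X -> d \in X ->
    e a b -> e b c -> e c d -> e d a -> a != c -> b != d -> False }.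

(** The induction hypothesis ranges over all relations on [T], not only over [e]: shortening a chain
    adds an edge, so the smaller graph is not an induced subgraph of the larger one. *)
Record minimal e X : Prop := Minimal {
  min_adm : admissible e X;
  min_bad : ~~ light_ids e X;
  min_ih : forall e' Y, #|Y| < #|X| -> admissible e' Y -> light_ids e' Y }.

Lemma nbrsS e X Y v : Y \subset X -> nbrs e Y v \subset nbrs e X v.
Proof.
by move=> sYX; apply/subsetP => u; rewrite !inE => /andP[/(subsetP sYX)-> ->].
Qed.

Lemma admissibleS e X Y : Y \subset X -> admissible e X -> admissible e Y.
Proof.
move=> sYX [sym irr dg c4]; split=> // [v vY|a b c d aY bY cY dY].
  apply: leq_trans (dg v (subsetP sYX v vY)).
  exact/subset_leq_card/nbrsS.
by apply: c4; apply: (subsetP sYX).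
Qed.

Definition nbhd e X S : {set T} := S :|: [set v in X | [exists u in S, e u v]].

(** If the weight dropped by 14 per vertex of [S], a light set of the remaining graph together with
    [S] would be light in [X]: no remaining vertex has a neighbour in [S], and [S] dominates
    everything deleted. *)
Lemma select_bound e X S : minimal e X -> S \subset X -> S != set0 ->
    {in S &, forall u v, ~~ e u v} ->
  weight e X < weight e (X :\: nbhd e X S) + 14 * #|S|.
Proof.
move=> [adm bad ih] sSX S0 indS; rewrite ltnNge; apply/negP => le_w.
have sym := adm_sym adm.
set Y := X :\: _ in le_w.
have sYX : Y \subset X by apply: subsetDl.
have ltYX : #|Y| < #|X|.
  apply: proper_card; rewrite properEneq sYX andbT; apply/eqP => eYX.
  have [v vS] := set0Pn _ S0; have := subsetP sSX v vS.
  by rewrite -eYX !inE vS.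
have /existsP[I /and4P[sIY /forall_inP indI /forall_inP domI wI]] :=
  ih e Y ltYX (admissibleS sYX adm).
case/negP: bad; apply/existsP; exists (I :|: S); apply/and4P; split.
- by rewrite subUset sSX (subset_trans sIY sYX).
- have IS u v : u \in I -> v \in S -> ~~ e u v.
    move=> /(subsetP sIY); rewrite !inE => /andP[/norP[_ nu] uX] vS.
    apply: contraNN nu => euv; rewrite uX /=.
    by apply/exists_inP; exists v => //; rewrite sym.
  apply/forall_inP => u; rewrite inE => /orP[uI|uS]; apply/forall_inP => v;
    rewrite inE => /orP[vI|vS].
  + by have /forall_inP := indI u uI; apply.
  + exact: IS.
  + by rewrite sym IS.
  + exact: indS.
- apply/forall_inP => v; rewrite !inE => /andP[/norP[vI vS] vX].
  have [vY|vY] := boolP (v \in Y).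
    have /exists_inP[u uI evu] : [exists u in I, e v u].
      by apply: domI; rewrite inE vI.
    by apply/exists_inP; exists u => //; rewrite inE uI.
  move: vY; rewrite !inE vX /= andbT (negPf vS) /= negbK => /exists_inP[u uS euv].
  by apply/exists_inP; exists u; rewrite ?inE ?uS ?orbT // sym.
- apply: leq_trans le_w; apply: (leq_trans (n := 14 * (#|I| + #|S|))).
    by rewrite leq_mul2l cardsU leq_subr.
  by rewrite mulnDr leq_add2r.
Qed.

Lemma minimal_neq0 e X : minimal e X -> X != set0.
Proof.
move=> [_ bad _]; apply: contraNneq bad => ->; apply/existsP; exists set0.
rewrite sub0set cards0 muln0 leq0n andbT /=; apply/andP; split;
  by apply/forall_inP => v; rewrite !inE.
Qed.

(** An isolated vertex can be selected alone: it weighs 14, and no other degree changes. *)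
Lemma minimal_deg_gt0 e X v : minimal e X -> v \in X -> 0 < deg e X v.
Proof.
move=> min vX; rewrite lt0n; apply/negP => /eqP dv0.
have [sym irr _ _] := min_adm min.
have nv u : u \in X -> ~~ e v u.
  move=> uX; apply: contra_eqN dv0 => evu; rewrite -lt0n; apply/card_gt0P.
  by exists u; rewrite !inE uX.
have := @select_bound e X [set v] min; rewrite sub1set vX => /(_ isT).
have -> : nbhd e X [set v] = [set v].
  apply/setP => u; rewrite !inE; case: eqP => //= _; apply/andP => -[uX].
  by move=> /exists_inP[w]; rewrite inE => /eqP->; apply/negP/nv.
have -> : [set v] != set0 by apply/set0Pn; exists v; rewrite inE.
have ind : {in [set v] &, forall u v, ~~ e u v}.
  by move=> u w; rewrite !inE => /eqP-> /eqP->; rewrite irr.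
move=> /(_ isT ind); rewrite ltnNge => /negP; apply.
rewrite [leqRHS](big_setD1 v vX) /= dv0 cards1 addnC leq_add2l.
apply: leq_sum => u; rewrite !inE => /andP[uv uX]; rewrite (_ : deg _ _ u = deg e X u) //.
rewrite /deg; congr #|pred_of_set _|; apply/setP => w; rewrite !inE.
by case: eqP => //= ->; rewrite sym (negPf (nv u uX)) andbF.
Qed.
End InducedSubgraphs.

(** * Patterns and the weight balance of a deletion *)

(* A pattern is a partially known graph on 0, ..., n-1: each vertex carries its
   degree in the host graph, or 0 if that degree is unknown, and the list of its
   known neighbours. *)
Definition pattern := seq (nat * seq nat).
Implicit Type s : pattern.

Definition dg s i : nat := (nth (0, [::]) s i).1.
Definition ad s i : seq nat := (nth (0, [::]) s i).2.

Definition set_deg s v d : pattern := set_nth (0, [::]) s v (d, ad s v).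
Definition add_arc s v w : pattern := set_nth (0, [::]) s v (dg s v, w :: ad s v).
Definition add_edge s v w : pattern := add_arc (add_arc s v w) w v.
Definition add_fresh s v : pattern := rcons (add_arc s v (size s)) (0, [:: v]).

(** The image need not be induced: the host may have further edges between images, as the pattern
    records only what is known so far. A vertex is completely known once its list is as long as its
    degree. *)
Record occurs (T : finType) (e : rel T) (X : {set T}) s (f : nat -> T) : Prop :=
  Occurs {
    occ_inj : forall i j, i < size s -> j < size s -> f i = f j -> i = j;
    occ_in : forall i, i < size s -> f i \in X;
    occ_dg : forall i, dg s i != 0 -> deg e X (f i) = dg s i;
    occ_ad : forall i j, j \in ad s i ->
      [/\ i < size s, j < size s, i \in ad s j & e (f i) (f j)];
    occ_uniq : forall i, uniq (ad s i) }.

Definition num_inside s (A : seq nat) i := count [in A] (ad s i).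

(** An unknown degree is replaced by the number of known neighbours. This is the least degree
    possible, and by convexity of [wt] the rise in weight for a given number of lost edges is
    largest there. *)
Definition loss_bound s A i :=
  let d := if dg s i == 0 then size (ad s i) else dg s i in
  wt (d - num_inside s A i) - wt d.

(* The sum weighted by 5 counts the edges leaving [A] that the pattern does
   not show: each of them costs at most 5 at its other end. *)
Definition selects s (S : seq nat) : bool :=
  let A := undup (S ++ flatten [seq ad s i | i <- S]) in
  let B := [seq i <- iota 0 (size s) | i \notin A] in
  [&& S != [::],
      all (fun i => [&& dg s i != 0, size (ad s i) == dg s i &
                        ~~ has [in S] (ad s i)]) S,
      all (fun i => dg s i != 0) A &
      14 * size S + sumn [seq loss_bound s A i | i <- B]
        + 5 * sumn [seq dg s i - num_inside s A i | i <- A]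
      <= sumn [seq wt (dg s i) | i <- A]
        + 5 * sumn [seq num_inside s A i | i <- B]].

Lemma dg_gt_size s i : dg s i != 0 -> i < size s.
Proof. by rewrite ltnNge; apply: contraNN => le; rewrite /dg nth_default. Qed.

(** From degree 3 down, successive lost edges cost 1, 3 and 5. *)
Lemma wt_loss d k : k <= d <= 3 -> wt (d - k) <= wt d + 5 * k.
Proof. by case: d k => [|[|[|[|d]]]] [|[|[|[|k]]]] //; lia. Qed.

(** The first [j] lost edges cost most at the least possible degree [d0], and each of the other
    [k - j] costs at most 5. The term [5 * j] stands on the left to avoid a truncated
    subtraction. *)
Lemma wt_loss_convex d0 d j k : d0 <= d <= 3 -> j <= d0 -> j <= k <= d ->
  wt (d - k) + 5 * j <= wt d + (wt (d0 - j) - wt d0) + 5 * k.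
Proof.
by case: d0 d j k => [|[|[|[|d0]]]] [|[|[|[|d]]]] [|[|[|[|j]]]] [|[|[|[|k]]]] //;
  lia.
Qed.

(** * Soundness of the weight balance *)

Section Occurrences.
Variables (T : finType) (e : rel T) (X : {set T}).
Hypothesis adm : admissible e X.
Let sym := adm_sym adm.

Lemma deg_nbhdD (A : {set T}) v :
  deg e X v = deg e (X :\: A) v + #|nbrs e X v :&: A|.
Proof.
rewrite /deg -(cardsID A (nbrs e X v)) addnC; congr (#|pred_of_set _| + _).
by apply/setP => u; rewrite !inE; case: (u \in A); rewrite ?andbF.
Qed.

Lemma sum_image (f : nat -> T) (r : seq nat) (F : T -> nat) :
  {in r &, injective f} -> uniq r ->
  \sum_(x in [set x in map f r]) F x = sumn [seq F (f i) | i <- r].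
Proof.
move=> inj ur; rewrite sumnE big_map -(big_map f xpredT F).
rewrite [RHS]big_uniq ?map_inj_in_uniq //.
by apply: eq_bigl => x; rewrite inE.
Qed.

Section WithPattern.
Variables (s : pattern) (f : nat -> T).
Hypothesis occ : occurs e X s f.

Lemma occ_nbr i j : j \in ad s i -> f j \in nbrs e X (f i).
Proof. by move=> /(occ_ad occ)[_ ltj _ eij]; rewrite inE eij (occ_in occ). Qed.

Lemma occ_count (p : pred nat) (A : {set T}) i :
    (forall j, j \in ad s i -> p j -> f j \in A) ->
  count p (ad s i) <= #|nbrs e X (f i) :&: A|.
Proof.
move=> pA; rewrite -size_filter -(size_map f).
have u : uniq (map f (filter p (ad s i))).
  rewrite map_inj_in_uniq ?filter_uniq ?(occ_uniq occ) // => j k.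
  rewrite !mem_filter => /andP[_ /(occ_ad occ)[_ ltj _ _]].
  by move=> /andP[_ /(occ_ad occ)[_ ltk _ _]]; apply: (occ_inj occ).
rewrite cardE; apply: uniq_leq_size => // x /mapP[j]; rewrite mem_filter.
by move=> /andP[pj aj] ->; rewrite mem_enum inE occ_nbr ?pA.
Qed.

Lemma occ_size_ad i : size (ad s i) <= deg e X (f i).
Proof.
rewrite -count_predT /deg -(setIT (nbrs e X (f i))).
by apply: occ_count => j _ _; rewrite inE.
Qed.

(** The known neighbours have distinct images and are as many as the degree, so they fill the
    neighbourhood. *)
Lemma occ_closed i u : dg s i != 0 -> size (ad s i) = dg s i ->
  u \in nbrs e X (f i) -> exists2 j, j \in ad s i & u = f j.
Proof.
move=> di0 ci unb.
have inj : {in ad s i &, injective f}.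
  move=> j k /(occ_ad occ)[_ ltj _ _] /(occ_ad occ)[_ ltk _ _].
  exact: (occ_inj occ).
have sub : [set x in map f (ad s i)] \subset nbrs e X (f i).
  by apply/subsetP => x; rewrite inE => /mapP[j aj ->]; apply: occ_nbr.
have eqN : [set x in map f (ad s i)] = nbrs e X (f i).
  have /card_uniqP c : uniq (map f (ad s i)) by rewrite map_inj_in_uniq ?(occ_uniq occ).
  by apply/eqP; rewrite eqEcard sub -/(deg e X (f i)) (occ_dg occ) // -ci cardsE c size_map /=.
by move: unb; rewrite -eqN inE => /mapP[j aj ->]; exists j.
Qed.

(** The numerical test bounds the change of weight in every host: unrecorded edges from [A] to the
    outside are charged 5 each, and unrecorded edges inside [A] are charged as if they left it. A
    passed test therefore contradicts [select_bound]. *)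
Lemma selects_bound S : minimal e X -> ~~ selects s S.
Proof.
move=> min; apply/negP; rewrite /selects.
set A := undup _; set B := filter _ _.
case/and4P => S0 /allP Sok /allP Adg; apply/negP; rewrite -ltnNge.
have AP i : (i \in A) = (i \in S) || has [in ad s i] S.
  rewrite mem_undup mem_cat; congr (_ || _).
  apply/flattenP/hasP => [[_ /mapP[j jS ->] aj]|[j jS aj]].
    by exists j => //; have [_ _ ? _] := occ_ad occ aj.
  exists (ad s j); first exact: map_f.
  by have [_ _ ? _] := occ_ad occ aj.
have ltA i : i \in A -> i < size s by move=> /Adg/dg_gt_size.
have ltB i : i \in B -> i < size s by rewrite mem_filter mem_iota => /andP[].
have injA : {in A &, injective f} by move=> i j /ltA ? /ltA ?; apply: (occ_inj occ).
have injB : {in B &, injective f} by move=> i j /ltB ? /ltB ?; apply: (occ_inj occ).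
have SA i : i \in S -> i \in A by rewrite AP => ->.
set A' := [set x in map f A]; set B' := [set x in map f B].
pose S' := [set x in map f S].
have sA'X : A' \subset X.
  by apply/subsetP => x; rewrite inE => /mapP[i /ltA lti ->]; apply: (occ_in occ).
have sS'X : S' \subset X.
  apply/subsetP => x; rewrite inE => /mapP[i /SA iA ->].
  by apply: (subsetP sA'X); rewrite inE map_f.
have S'0 : S' != set0.
  have [i iS] : exists i, i \in S by case: (S) S0 => // i r _; exists i; rewrite inE eqxx.
  by apply/set0Pn; exists (f i); rewrite inE map_f.
have closedS i : i \in S -> dg s i != 0 /\ size (ad s i) = dg s i.
  by move=> /Sok/and3P[? /eqP].
have indS' : {in S' &, forall u v, ~~ e u v}.
  move=> u v; rewrite !inE => /mapP[i iS ->] /mapP[j jS ->]; apply/negP => eij.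
  have [di ci] := closedS i iS.
  have [|k ak fjk] := occ_closed di ci (u := f j).
    by rewrite inE eij (occ_in occ) ?ltA ?SA.
  have [_ ltk _ _] := occ_ad occ ak.
  have /and3P[_ _ /hasPn/(_ k ak)/negP[]] := Sok i iS.
  by rewrite /= -(occ_inj occ _ ltk fjk) // ltA ?SA.
(* The neighbourhoods of the vertices of [S] are completely known, so no vertex outside the pattern
   enters the closed neighbourhood. *)
have nbA : nbhd e X S' = A'.
  apply/setP => x; rewrite !inE; apply/orP/mapP.
    case=> [/mapP[i /SA iA ->]|/andP[xX /exists_inP[u]]]; first by exists i.
    rewrite inE => /mapP[i iS ->] ei; have [di ci] := closedS i iS.
    have [|j aj ->] := occ_closed di ci (u := x); first by rewrite inE xX.
    exists j => //; rewrite AP; apply/orP; right; apply/hasP; exists i => //=.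
    by have [_ _] := occ_ad occ aj.
  case=> i iA ->; move: (iA); rewrite AP => /orP[iS|]; first by left; apply: map_f.
  move=> /hasP[j jS aj]; right; rewrite (occ_in occ) ?ltA //=.
  apply/exists_inP; exists (f j); first by rewrite inE map_f.
  by have [_ _ _] := occ_ad occ aj; rewrite sym.
have := select_bound min sS'X S'0 indS'; rewrite nbA; set Y := X :\: A' => lt_w.
(* The true number of edges that [y] loses; the pattern provides only the lower bound
   [num_inside]. *)
pose k y := #|nbrs e X y :&: A'|.
have insideP i : num_inside s A i <= k (f i).
  by apply: occ_count => j _ jA; rewrite inE map_f.
(* Double counting from the side of [A']: a vertex of [A] has at least [num_inside] neighbours in
   [A'], so at most the rest of its degree leads out. *)
have sum_k : \sum_(y in Y) k y <= sumn [seq dg s i - num_inside s A i | i <- A].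
  have kE y : k y = \sum_(a in A') e y a.
    rewrite /k -sum1_card big_mkcond [RHS]big_mkcond /=; apply: eq_bigr => a _.
    rewrite in_setI; have [aA|_] := boolP (a \in A'); last by rewrite andbF.
    by rewrite andbT inE (subsetP sA'X) //=; case: (e y a).
  under eq_bigr do rewrite kE.
  rewrite exchange_big /= sum_image ?undup_uniq // !sumnE !big_map.
  rewrite !big_seq; apply: leq_sum => i iA.
  rewrite leq_subRL; last first.
    by rewrite (leq_trans (insideP i)) // -(occ_dg occ) ?Adg // subset_leq_card ?subsetIl.
  rewrite -(occ_dg occ) ?Adg // (deg_nbhdD A') addnC leq_add ?insideP //.
  rewrite /deg -sum1_card big_mkcond [leqRHS]big_mkcond /=; apply: leq_sum => y _.
  rewrite !inE sym; case: (y \in X); last by rewrite andbF.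
  by case: (y \in _); case: (e _ y).
have sB'Y : B' \subset Y.
  apply/subsetP => x; rewrite inE => /mapP[i iB ->].
  rewrite inE (occ_in occ) ?ltB // andbT inE; apply/mapP => -[j jA fij].
  have eij : i = j by apply: (occ_inj occ) fij; [exact: ltB | exact: ltA].
  by move: iB; rewrite eij mem_filter jA.
have degY y : y \in Y -> k y <= deg e X y <= 3.
  rewrite inE => /andP[_ yX]; rewrite (adm_deg adm) // andbT.
  by rewrite subset_leq_card // subsetIl.
have degYE y : deg e Y y = deg e X y - k y by rewrite (deg_nbhdD A') addnK.
(* Vertices outside the pattern pay 5 per lost edge; those of [B] pay [loss_bound] for their
   recorded edges and 5 for each further one. *)
have wY : weight e Y + 5 * sumn [seq num_inside s A i | i <- B] <=
    \sum_(y in Y) wt (deg e X y) + sumn [seq loss_bound s A i | i <- B]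
     + 5 * \sum_(y in Y) k y.
  have splitY F : \sum_(y in Y) F y =
      sumn [seq F (f i) | i <- B] + \sum_(y in Y :\: B') F y.
    rewrite (big_setID B') /= (setIidPr sB'Y) sum_image //.
    by rewrite filter_uniq ?iota_uniq.
  rewrite /weight !splitY !mulnDr.
  have rest : \sum_(y in Y :\: B') wt (deg e Y y) <=
      \sum_(y in Y :\: B') wt (deg e X y) + 5 * \sum_(y in Y :\: B') k y.
    rewrite big_distrr -big_split /=; apply: leq_sum => y /setDP[yY _].
    by rewrite degYE; apply/wt_loss/degY.
  have known : sumn [seq wt (deg e Y (f i)) | i <- B]
       + 5 * sumn [seq num_inside s A i | i <- B] <=
      sumn [seq wt (deg e X (f i)) | i <- B] + sumn [seq loss_bound s A i | i <- B]
       + 5 * sumn [seq k (f i) | i <- B].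
    rewrite !sumnE !big_map !big_distrr -!big_split /= !big_seq.
    apply: leq_sum => i iB; have fiY : f i \in Y by rewrite (subsetP sB'Y) // inE map_f.
    have /andP[le_k le3] := degY _ fiY.
    rewrite degYE; apply: wt_loss_convex; rewrite ?insideP ?le_k ?le3 //.
      by case: eqP => [_|/eqP d0]; rewrite ?occ_size_ad ?(occ_dg occ) ?leqnn.
    case: eqP => [_|/eqP d0]; first exact: count_size.
    by rewrite -(occ_dg occ) // (leq_trans (insideP i)).
  lia.
have wX : weight e X = \sum_(y in Y) wt (deg e X y) + sumn [seq wt (dg s i) | i <- A].
  rewrite /weight (big_setID A') /= (setIidPr sA'X) addnC; congr (_ + _).
  rewrite sum_image ?undup_uniq //; congr sumn; apply/eq_in_map => i iA.
  by rewrite (occ_dg occ) // Adg.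
have cS : #|S'| <= size S by rewrite cardsE -(size_map f) card_size.
lia.
Qed.

End WithPattern.
End Occurrences.

(** * Refutation trees *)

(** Symmetric lists without repetition are part of [occurs], so a library pattern must have them
    before an embedding can make it occur. *)
Definition well_formed (s : pattern) : bool :=
  all (fun i => uniq (ad s i) && all (fun j => [&& j < size s & i \in ad s j]) (ad s i))
    (iota 0 (size s)).

(** Extra edges of [s] between the images are harmless, because an occurrence of [p] asserts only
    what [p] records. *)
Definition embeds (p s : pattern) (m : seq nat) : bool :=
  [&& size m == size p, uniq m, all (gtn (size s)) m &
      all (fun i => [&& (dg p i == 0) || (dg p i == dg s (nth 0 m i)) &
                        all (fun j => nth 0 m j \in ad s (nth 0 m i)) (ad p i)])
        (iota 0 (size p))].

(** A vertex of unknown degree can take neighbours up to the maximum degree 3. *)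
Definition saturated (s : pattern) v : bool :=
  size (ad s v) == if dg s v == 0 then 3 else dg s v.

(** An edge between [v] and [w] would close such a path to a 4-cycle. *)
Definition path3 (s : pattern) v w : bool :=
  has (fun a => (a != w) && has (fun b => [&& b != v, b != w & w \in ad s b]) (ad s a))
    (ad s v).

Definition may_join (s : pattern) v w : bool :=
  [&& w != v, w \notin ad s v, ~~ saturated s w & ~~ path3 s v w].

(* All ways to choose [h] further neighbours of [v] among the first [n]
   vertices of the pattern and new vertices. *)
Fixpoint completions (s : pattern) v n h : seq pattern :=
  if h is h'.+1 then
    if n is n'.+1 then
      let rest := completions s v n' h in
      if may_join s v n' then completions (add_edge s v n') v n' h' ++ rest else rest
    else [:: iter h (add_fresh^~ v) s]
  else [:: s].

(* Refutation trees: select an independent set, find an already refuted pattern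
   inside the current one, branch on the degree of a vertex, or branch on all
   ways to complete the neighbourhood of a vertex. *)
Inductive cert :=
| Sel of seq nat
| Lib of nat & seq nat
| Deg of nat & cert & cert & cert
| Nbr of nat & seq cert.

Fixpoint refutes (lib : seq pattern) (s : pattern) (c : cert) {struct c} : bool :=
  match c with
  | Sel r => selects s r
  | Lib i m => (i < size lib) && embeds (nth [::] lib i) s m
  | Deg v c1 c2 c3 =>
      [&& dg s v == 0, 0 < size (ad s v),
          (1 < size (ad s v)) || refutes lib (set_deg s v 1) c1,
          (2 < size (ad s v)) || refutes lib (set_deg s v 2) c2 &
          refutes lib (set_deg s v 3) c3]
  | Nbr v cs => (dg s v != 0) &&
      (fix refutes_all (cs : seq cert) (ss : seq pattern) : bool :=
         match cs, ss with
         | _, [::] => true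
         | c :: cs, s :: ss => refutes lib s c && refutes_all cs ss
         | _, _ => false
         end) cs (completions s v (size s) (dg s v - size (ad s v)))
  end.

(** The library grows at its right end, so the index of a refuted pattern stays valid in all later
    trees. *)
Fixpoint refutes_chain (lib : seq pattern) (l : seq (pattern * cert)) : bool :=
  if l is (p, c) :: l then
    [&& well_formed p, refutes lib p c & refutes_chain (rcons lib p) l]
  else true.

Section PatternUpdates.

Lemma dg_set s v x i : dg (set_nth (0, [::]) s v x) i = if i == v then x.1 else dg s i.
Proof. by rewrite /dg nth_set_nth /=; case: eqP. Qed.

Lemma ad_set s v x i : ad (set_nth (0, [::]) s v x) i = if i == v then x.2 else ad s i.
Proof. by rewrite /ad nth_set_nth /=; case: eqP. Qed.

Lemma size_set s v x : v < size s -> size (set_nth (0, [::]) s v x) = size s.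
Proof. by rewrite size_set_nth => /maxn_idPr. Qed.

Lemma dg_add_arc s v w i : dg (add_arc s v w) i = dg s i.
Proof. by rewrite dg_set; case: eqP => // ->. Qed.

Lemma ad_add_arc s v w i :
  ad (add_arc s v w) i = if i == v then w :: ad s v else ad s i.
Proof. exact: ad_set. Qed.

Lemma dg_add_edge s v w i : dg (add_edge s v w) i = dg s i.
Proof. by rewrite !dg_add_arc. Qed.

Lemma ad_add_edge s v w i : v != w ->
  ad (add_edge s v w) i =
    if i == v then w :: ad s v else if i == w then v :: ad s w else ad s i.
Proof.
rewrite eq_sym => /negPf vw; rewrite !ad_add_arc vw.
by case: (i =P w) => [->|//]; rewrite vw.
Qed.

Lemma size_add_edge s v w : v < size s -> w < size s -> size (add_edge s v w) = size s.
Proof. by move=> lv lw; rewrite !size_set. Qed.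

Lemma dg_add_fresh s v i : v < size s -> dg (add_fresh s v) i = dg s i.
Proof.
move=> lv; rewrite -(dg_add_arc s v (size s)) /dg nth_rcons size_set //.
by case: ltngtP => // [lt|->]; rewrite nth_default ?size_set // ltnW.
Qed.

Lemma ad_add_fresh s v i : v < size s ->
  ad (add_fresh s v) i = if i == v then size s :: ad s v
                         else if i == size s then [:: v] else ad s i.
Proof.
move=> lv; rewrite [LHS]/ad nth_rcons size_set //.
case: ltngtP => [lt|lt|->] /=; last by rewrite gtn_eqF.
  by rewrite -/(ad _ i) ad_add_arc.
by rewrite gtn_eqF ?(ltn_trans lv) // /ad nth_default // ltnW.
Qed.
End PatternUpdates.

(** * Soundness of refutation trees *)

Section Refutation.
Variables (T : finType) (e : rel T) (X : {set T}).
Hypothesis min : minimal e X.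
Let adm := min_adm min.
Let sym := adm_sym adm.
Let irr := adm_irr adm.
Implicit Types (p : pattern) (f : nat -> T).

Definition refuted p := forall f, ~ occurs e X p f.

Lemma occurs_embeds p s m f : well_formed p -> embeds p s m -> occurs e X s f ->
  occurs e X p (fun i => f (nth 0 m i)).
Proof.
move=> /allP wf /and4P[/eqP sm um /allP lm /allP emb] occ.
have inp i : i < size p -> i \in iota 0 (size p) by rewrite mem_iota.
have ltm i : i < size p -> nth 0 m i < size s by rewrite -sm => lt; apply/lm/mem_nth.
have lt_ad i j : j \in ad p i -> i < size p.
  by rewrite ltnNge; apply: contraL => le; rewrite /ad nth_default.
split=> [i j li lj /(occ_inj occ) eij|i li|i di|i j aj|i].
- by apply/eqP; rewrite -(nth_uniq 0 _ _ um) ?sm // eij ?ltm.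
- by rewrite (occ_in occ) ?ltm.
- have /emb/andP[/orP[/eqP d0|/eqP eqd] _] := inp i (dg_gt_size di).
    by rewrite d0 in di.
  by rewrite eqd (occ_dg occ) // -eqd.
- have li := lt_ad _ _ aj.
  have /wf/andP[_ /allP/(_ j aj)/andP[-> ->]] := inp i li.
  have /emb/andP[_ /allP/(_ j aj)/(occ_ad occ)[_ _ _ ->]] := inp i li.
  by rewrite li.
- have [li|le] := ltnP i (size p); last by rewrite /ad nth_default.
  by have /wf/andP[] := inp i li.
Qed.

Lemma occurs_set_deg s v f d :
    v < size s -> deg e X (f v) = d -> occurs e X s f ->
  occurs e X (set_deg s v d) f.
Proof.
move=> lv dv occ; split=> [i j|i|i|i j|i]; rewrite ?size_set //.
- exact: (occ_inj occ).
- exact: (occ_in occ).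
- by rewrite dg_set; case: (i =P v) => [->|_]; [rewrite dv | apply: (occ_dg occ)].
- by rewrite !ad_set /=; do 2![case: eqP => [->|_] //]; apply: (occ_ad occ).
- by rewrite ad_set; case: eqP => _ /=; apply: (occ_uniq occ).
Qed.

Lemma occurs_add_edge s v w f : v < size s -> w < size s -> w \notin ad s v ->
    e (f v) (f w) -> occurs e X s f ->
  occurs e X (add_edge s v w) f.
Proof.
move=> lv lw nwv evw occ.
have vw : v != w by apply: contraTneq evw => ->; rewrite irr.
have nvw : v \notin ad s w by apply: contra nwv => /(occ_ad occ)[].
split=> [i j|i|i|i j|i]; rewrite ?size_add_edge ?dg_add_edge //.
- exact: (occ_inj occ).
- exact: (occ_in occ).
- exact: (occ_dg occ).
- rewrite !ad_add_edge //; case: (i =P v) => [->|/eqP iv].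
    rewrite inE => /orP[/eqP->|aj].
      by rewrite eq_sym (negPf vw) eqxx inE eqxx.
    have [_ lj avj ej] := occ_ad occ aj; rewrite lv lj ej.
    case: (j =P v) => [ejv|_]; first by move: avj; rewrite ejv inE orbC => ->.
    by case: (j =P w) => [<-|_]; rewrite ?inE ?avj ?orbT.
  case: (i =P w) => [->|/eqP iw].
    rewrite inE => /orP[/eqP->|aj].
      by rewrite eqxx inE eqxx sym.
    have [_ lj avj ej] := occ_ad occ aj; rewrite lw lj ej.
    case: (j =P v) => [<-|_]; first by rewrite inE avj orbT.
    by case: (j =P w) => [ejw|_] //; move: avj; rewrite ejw inE orbC => ->.
  move=> aj; have [li lj avj ej] := occ_ad occ aj; rewrite li lj ej.
  case: (j =P v) => [<-|_]; first by rewrite inE avj orbT.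
  by case: (j =P w) => [<-|_]; rewrite ?inE ?avj ?orbT.
- rewrite ad_add_edge //; case: eqP => _ /=; first by rewrite nwv (occ_uniq occ).
  by case: eqP => _ /=; rewrite ?nvw (occ_uniq occ).
Qed.

Definition extend (f : nat -> T) n u : nat -> T := fun i => if i == n then u else f i.

Lemma occurs_add_fresh s v u f : v < size s -> u \in nbrs e X (f v) ->
    (forall i, i < size s -> f i != u) -> occurs e X s f ->
  occurs e X (add_fresh s v) (extend f (size s) u).
Proof.
rewrite inE => lv /andP[uX evu] new occ.
have fE i : i < size s -> extend f (size s) u i = f i by rewrite /extend => /ltn_eqF->.
have fn : extend f (size s) u (size s) = u by rewrite /extend eqxx.
have sE : size (add_fresh s v) = (size s).+1 by rewrite size_rcons size_set.
split=> [i j|i|i|i j|i]; rewrite ?sE ?dg_add_fresh // ?ltnS.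
- rewrite leq_eqVlt => /predU1P[->|li]; rewrite leq_eqVlt => /predU1P[->|lj] //;
    rewrite ?fn ?fE //.
  + by move=> eu; have := new _ lj; rewrite -eu eqxx.
  + by move=> eu; have := new _ li; rewrite eu eqxx.
  + exact: (occ_inj occ).
- rewrite leq_eqVlt => /predU1P[->|li]; rewrite ?fn ?fE //.
  exact: (occ_in occ).
- by move=> di; rewrite fE ?(occ_dg occ) ?dg_gt_size.
- rewrite !ad_add_fresh //; case: (i =P v) => [->|/eqP iv].
    rewrite inE => /orP[/eqP->|aj].
      by rewrite leqnn (ltnW lv) (gtn_eqF lv) eqxx inE eqxx fn fE.
    have [_ lj avj ej] := occ_ad occ aj; rewrite !fE // ej (ltnW lv) (ltnW lj).
    case: (j =P v) => [ejv|_]; first by move: avj; rewrite ejv inE orbC => ->.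
    by rewrite (ltn_eqF lj).
  case: (i =P size s) => [->|/eqP iw].
    rewrite inE => /eqP->; rewrite eqxx fn fE // sym evu inE eqxx leqnn.
    by rewrite (ltnW lv).
  move=> aj; have [li lj avj ej] := occ_ad occ aj; rewrite !fE // ej.
  rewrite (ltnW li) (ltnW lj) (ltn_eqF lj).
  by case: (j =P v) => [<-|_]; rewrite ?inE ?avj ?orbT.
- rewrite ad_add_fresh //; case: eqP => _ /=.
    rewrite (occ_uniq occ) andbT; apply/negP => /(occ_ad occ)[_].
    by rewrite ltnn.
  by case: eqP => _ //=; rewrite (occ_uniq occ).
Qed.

(** The pruning of [completions] discards no real neighbour: an edge to a saturated vertex would
    exceed its degree, and an edge across a [path3] would give a 4-cycle. *)
Lemma may_joinP s v w f : v < size s -> w < size s -> w \notin ad s v ->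
  e (f v) (f w) -> occurs e X s f -> may_join s v w.
Proof.
move=> lv lw nwv evw occ.
have vw : v != w by apply: contraTneq evw => ->; rewrite irr.
rewrite /may_join nwv eq_sym vw /=; apply/andP; split.
  have : size (ad s w) < deg e X (f w).
    have := @occ_size_ad _ _ _ _ _ (occurs_add_edge lv lw nwv evw occ) w.
    by rewrite ad_add_edge // eq_sym (negPf vw) eqxx.
  apply: contraTN => /eqP->; rewrite -leqNgt; case: eqP => [_|/eqP d0].
    by rewrite (adm_deg adm) ?(occ_in occ).
  by rewrite (occ_dg occ).
apply/hasP => -[a /(occ_ad occ)[_ la _ eva] /andP[aw]].
case/hasP => b /(occ_ad occ)[_ lb _ eab] /and3P[bv bw /(occ_ad occ)[_ _ _ ebw]].
apply: (adm_C4 adm _ _ _ _ eva eab ebw); rewrite ?(occ_in occ) // 1?sym //.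
  by apply: contraNneq bv => /(occ_inj occ)->.
by apply: contraNneq aw => /(occ_inj occ)->.
Qed.

(** The last hypothesis is the invariant of the recursion: a neighbour of [v] that lies in the
    pattern but is not yet recorded has index below [n]. At [n = 0] every missing neighbour is
    therefore a new vertex. *)
Lemma completionsP s v n h f : occurs e X s f -> v < size s -> n <= size s ->
    dg s v != 0 -> h = dg s v - size (ad s v) ->
    (forall i, i < size s -> e (f v) (f i) -> i \notin ad s v -> i < n) ->
  exists2 s', s' \in completions s v n h & exists f', occurs e X s' f'.
Proof.
elim: n s h f => [|n IHn] s [|h] f occ lv len dv eh old /=;
  try by exists s; [rewrite inE | exists f].
- exists (iter h.+1 (add_fresh^~ v) s); first by rewrite inE.
  elim: h.+1 s f occ lv {len} dv eh old => [|k IHk] s f occ lv dv eh old.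
    by exists f.
  have [u unb new] : exists2 u, u \in nbrs e X (f v) & forall i, i < size s -> f i != u.
    (* The degree exceeds the number of recorded neighbours, so some neighbour is unrecorded; by the
       invariant it lies outside the pattern. *)
    have : 0 < #|nbrs e X (f v) :\: [set x in map f (ad s v)]|.
      rewrite cardsD -/(deg e X (f v)) (occ_dg occ) // subn_gt0.
      have lt : size (ad s v) < dg s v by rewrite -subn_gt0 -eh.
      apply: leq_ltn_trans lt; rewrite -(size_map f).
      apply: leq_trans (card_size _); apply/subset_leq_card/subsetP => x.
      by rewrite inE in_set => /andP[].
    case/card_gt0P => u; rewrite in_setD => /andP[nu unb]; exists u => // i li.
    apply: contraNneq nu => eu; rewrite inE; apply/mapP; exists i => //.
    have [//|ni] := boolP (i \in ad s v).
    move: unb; rewrite inE -eu => /andP[_ ei].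
    by have := old i li ei ni.
  have sE : size (add_fresh s v) = (size s).+1 by rewrite size_rcons size_set.
  have adE : ad (add_fresh s v) v = size s :: ad s v by rewrite ad_add_fresh ?eqxx.
  rewrite iterSr; apply: (IHk _ _ (occurs_add_fresh lv unb new occ)).
  - by rewrite sE ltnW.
  - by rewrite dg_add_fresh.
  - by rewrite dg_add_fresh // adE /= subnS -eh.
  move=> i; rewrite sE ltnS leq_eqVlt adE inE => /predU1P[->|li]; first by rewrite eqxx.
  by rewrite /extend (ltn_eqF lv) (ltn_eqF li) /=; apply: old.
(* If [n] is an unrecorded neighbour, the branch that adds the edge applies; otherwise the invariant
   already holds with the bound [n]. *)
- have [evn|nvn] := boolP (e (f v) (f n) && (n \notin ad s v)).
    case/andP: evn => evn nad; rewrite (may_joinP lv len nad evn occ).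
    have vn : v != n by apply: contraTneq evn => ->; rewrite irr.
    have occ' := occurs_add_edge lv len nad evn occ.
    have [] := IHn _ h f occ'; rewrite ?size_add_edge ?dg_add_edge ?(ltnW len) //.
    + by rewrite ad_add_edge // eqxx /= subnS -eh.
    + move=> i li ei; rewrite ad_add_edge // eqxx inE => /norP[ni nad'].
      by have := old i li ei nad'; rewrite ltnS leq_eqVlt (negPf ni).
    by move=> s' s'in ex; exists s' => //; rewrite mem_cat s'in.
  have [] := IHn s h.+1 f occ lv (ltnW len) dv eh.
    move=> i li ei nad; have := old i li ei nad.
    rewrite ltnS leq_eqVlt => /predU1P[ein|//].
    by move: nvn; rewrite -ein ei nad.
  move=> s' s'in ex; exists s' => //.
  by case: ifP => _ //; rewrite mem_cat s'in orbT.
Qed.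

Lemma refutesP lib s c : all well_formed lib -> {in lib, forall p, refuted p} ->
  refutes lib s c -> refuted s.
Proof.
(* [cert] nests [seq cert], and the generated induction principle has no hypothesis for the members
   of the list; hence a direct [fix]. *)
move=> wf ref; move: c s; fix IH 1 => -[S|i m|v c1 c2 c3|v cs] s /=.
- by move=> sel f occ; move: (selects_bound adm occ S min); rewrite sel.
- case/andP => li emb f occ; have pin := mem_nth [::] li.
  exact: (ref _ pin) (occurs_embeds (allP wf _ pin) emb occ).
- case/and5P => d0 ad0 r1 r2 r3 f occ.
  have lv : v < size s.
    by rewrite ltnNge; apply: contraL ad0 => le; rewrite /ad nth_default.
  have le3 := adm_deg adm (occ_in occ lv).
  have le_ad := occ_size_ad occ v.
  (* The known neighbour excludes degree 0, and a degree below the number of known neighbours needs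
     no tree. *)
  case dE: (deg e X (f v)) le3 le_ad => [|[|[|[|d]]]] // _ le_ad.
  + by rewrite leqNgt ad0 in le_ad.
  + move: r1; rewrite ltnNge le_ad => r1.
    exact: (IH _ _ r1) (occurs_set_deg lv dE occ).
  + move: r2; rewrite ltnNge le_ad => r2.
    exact: (IH _ _ r2) (occurs_set_deg lv dE occ).
  + exact: (IH _ _ r3) (occurs_set_deg lv dE occ).
- case/andP => dv rs f occ.
  have [||s' s'in [f' occ']] := @completionsP s v (size s) _ f occ _ (leqnn _) dv erefl.
  + exact: dg_gt_size.
  + by [].
  suff : refuted s' by apply; exact: occ'.
  elim: cs (completions _ _ _ _) rs s'in {f' occ'} => [|c cs IHcs] [|t ts] //=.
  case/andP => rt rts; rewrite inE => /predU1P[->|]; first exact: IH rt.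
  exact: IHcs.
Qed.

Lemma refutes_chainP lib l : all well_formed lib -> {in lib, forall p, refuted p} ->
    refutes_chain lib l ->
  all well_formed (lib ++ unzip1 l) /\ {in lib ++ unzip1 l, forall p, refuted p}.
Proof.
elim: l lib => [|[p c] l IHl] lib wf ref /=; first by rewrite cats0.
case/and3P => wfp /(refutesP wf ref) refp; rewrite -cat_rcons; apply: IHl.
  by rewrite all_rcons wfp.
by move=> q; rewrite mem_rcons inE => /predU1P[->|/ref].
Qed.

End Refutation.

(** * Shortening chains *)

Section Rewiring.
Variables (T : finType) (e : rel T) (X D : {set T}) (x y : T).
Let Y := X :\: D.
Hypotheses (adm : admissible e X) (xY : x \in Y) (yY : y \in Y).
Hypotheses (nexy : ~~ e x y) (xy : x != y).
Let sym := adm_sym adm.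
Let irr := adm_irr adm.

Definition new_edge u v := ((u == x) && (v == y)) || ((u == y) && (v == x)).
Definition rewire u v := e u v || new_edge u v.

Lemma deg_rewire v : v \in Y -> deg rewire Y v = deg e Y v + ((v == x) || (v == y)).
Proof.
move=> vY; rewrite /deg.
have [->|vx] := eqVneq v x.
  have -> : nbrs rewire Y x = y |: nbrs e Y x.
    apply/setP => u; rewrite !inE /rewire /new_edge eqxx (negPf xy) /= orbF.
    have [->|_] := eqVneq u y; last by rewrite orbF.
    by move: yY; rewrite inE => ->; rewrite orbT.
  by rewrite cardsU1 inE (negPf nexy) andbF addnC.
have [->|vy] := eqVneq v y.
  have -> : nbrs rewire Y y = x |: nbrs e Y y.
    apply/setP => u; rewrite !inE /rewire /new_edge eqxx eq_sym (negPf xy) /=.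
    have [->|_] := eqVneq u x; last by rewrite orbF.
    by move: xY; rewrite inE => ->; rewrite orbT.
  by rewrite cardsU1 inE sym (negPf nexy) andbF addnC.
rewrite addn0; congr #|pred_of_set _|; apply/setP => u.
by rewrite !inE /rewire /new_edge (negPf vx) (negPf vy) orbF.
Qed.

(** A 4-cycle through the new edge would be a path of three old edges between [x] and [y], closed by
    that edge. *)
Lemma rewire_admissible :
    {in Y, forall v, deg rewire Y v <= 3} ->
    (forall a b, a \in Y -> b \in Y -> e x a -> e a b -> e b y ->
       a != y -> b != x -> False) ->
  admissible rewire Y.
Proof.
move=> deg3 nopath; have sYX : Y \subset X by apply: subsetDl.
have new_sym u v : new_edge u v = new_edge v u.
  by rewrite /new_edge orbC ![(_ == y) && _]andbC.
split=> //.
- by move=> u v; rewrite /rewire sym new_sym.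
- move=> u; rewrite /rewire /new_edge irr /=; apply/negP => /orP[] /andP[/eqP-> ].
    by rewrite (negPf xy).
  by rewrite eq_sym (negPf xy).
(* Up to rotation the new edge comes first. The other three edges are old: a second use of the new
   edge would identify opposite corners or produce a loop. *)
have newC4 a b c d : a \in Y -> b \in Y -> c \in Y -> d \in Y -> new_edge a b ->
    rewire b c -> rewire c d -> rewire d a -> a != c -> b != d -> False.
  move=> aY bY cY dY; have yx : y != x by rewrite eq_sym.
  case/orP=> -[] /andP[/eqP-> /eqP->]; rewrite /rewire /new_edge ?eqxx ?(negPf xy) ?(negPf yx) /=.
    rewrite ?andbF ?andbT ?orbF /= => bc cd da ac bd.
    move: bc cd da; rewrite [c == x]eq_sym (negPf ac) [d == y]eq_sym (negPf bd).
    rewrite ?andbF ?andbT ?orbF /= => bc /orP[cd|/andP[/eqP cy _]] da; last first.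
      by rewrite cy irr in bc.
    by apply: (nopath d c); rewrite // 1?sym // eq_sym.
  rewrite ?andbF ?andbT ?orbF /= => bc cd da ac bd.
  move: bc cd da; rewrite [c == y]eq_sym (negPf ac) [d == x]eq_sym (negPf bd).
  rewrite ?andbF ?andbT ?orbF /= => bc /orP[cd|/andP[/eqP cy _]] da; last first.
    by rewrite cy irr in bc.
  by apply: (nopath c d); rewrite // eq_sym.
move=> a b c d aY bY cY dY ab bc cd da ac bd.
have [] := adm_C4 adm _ _ _ _ _ _ _ _ ac bd; rewrite ?(subsetP sYX) //.
- by case/orP: (ab) => // nw; case: (newC4 a b c d) => //; rewrite eq_sym.
- by case/orP: (bc) => // nw; case: (newC4 b c d a) => //; rewrite eq_sym.
- by case/orP: (cd) => // nw; case: (newC4 c d a b) => //; rewrite eq_sym.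
- by case/orP: (da) => // nw; case: (newC4 d a b c) => //; rewrite eq_sym.
Qed.

End Rewiring.

Section OccurrenceNeighbours.
Variables (T : finType) (e : rel T) (X : {set T}) (s : pattern) (f : nat -> T).
Hypothesis occ : occurs e X s f.

Lemma occ_adjE i u : dg s i != 0 -> size (ad s i) = dg s i -> u \in X ->
  e (f i) u = (u \in map f (ad s i)).
Proof.
move=> di ci uX; apply/idP/mapP => [ei|[j aj ->]]; last by have [] := occ_ad occ aj.
by have [|j aj ->] := occ_closed occ di ci (u := u); [rewrite inE uX | exists j].
Qed.

Lemma occ_neq i j : i < size s -> j < size s -> (f i == f j) = (i == j).
Proof. by move=> li lj; apply/eqP/eqP => [/(occ_inj occ)->|->]. Qed.
End OccurrenceNeighbours.

Definition leaf_path : pattern :=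
  [:: (3, [:: 1; 3]); (3, [:: 0; 2; 4]); (3, [:: 1; 5]); (1, [:: 0]); (1, [:: 1]); (1, [:: 2])].
(** It appears when the outer vertices of [leaf_path] are already adjacent, so that no edge can be
    added. *)
Definition leaf_triangle : pattern :=
  [:: (3, [:: 1; 2; 3]); (1, [:: 0]); (3, [:: 0; 3]); (3, [:: 0; 2])].
(** The obstruction to the shortening: a path of three edges between the outer vertices, which the
    added edge would close to a 4-cycle. *)
Definition leaf_pentagon : pattern :=
  add_edge (add_fresh (add_fresh leaf_path 0) 2) 6 7.

(* Delete the middle vertex and its leaf and join the two outer vertices: an
   outer vertex outside the independent dominating set of the smaller graph is
   dominated by its own leaf, so adding the deleted leaf suffices. *)
Lemma leaf_path_refuted (T : finType) (e : rel T) (X : {set T}) : minimal e X ->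
  refuted e X leaf_triangle -> refuted e X leaf_pentagon -> refuted e X leaf_path.
Proof.
move=> min ref3 ref5 f occ; have adm := min_adm min.
have sym := adm_sym adm; have irr := adm_irr adm.
have inX i : i < 6 -> f i \in X by apply: (occ_in occ).
have eqf i j : i < 6 -> j < 6 -> (f i == f j) = (i == j) by apply: (occ_neq occ).
have e1 u : u \in X -> e (f 1) u = (u \in [:: f 0; f 2; f 4]) by apply: (occ_adjE occ).
have e3 u : u \in X -> e (f 3) u = (u \in [:: f 0]) by apply: (occ_adjE occ).
have e4 u : u \in X -> e (f 4) u = (u \in [:: f 1]) by apply: (occ_adjE occ).
have e5 u : u \in X -> e (f 5) u = (u \in [:: f 2]) by apply: (occ_adjE occ).
have nexy : ~~ e (f 0) (f 2).
  apply/negP => exy; have occ' := @occurs_add_edge _ _ _ min leaf_path 0 2 f isT isT isT exy occ.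
  by have := ref3 _ (@occurs_embeds _ _ _ leaf_triangle (add_edge leaf_path 0 2) [:: 1; 4; 0; 2] f isT isT occ').
pose D := [set f 1; f 4]; set Y := X :\: D.
have xY : f 0 \in Y by rewrite !inE inX // !eqf.
have yY : f 2 \in Y by rewrite !inE inX // !eqf.
have xy : f 0 != f 2 by rewrite eqf.
(* Each outer vertex exchanges its edge to vertex 1 for the added edge; no other remaining vertex is
   affected. *)
have degY v : v \in Y -> deg (rewire e (f 0) (f 2)) Y v = deg e X v.
  move=> vY; rewrite deg_rewire // (deg_nbhdD e X D); congr (_ + _).
  move: vY; rewrite !inE => /andP[/norP[v1 v4] vX].
  have -> : nbrs e X v :&: D = if (v == f 0) || (v == f 2) then [set f 1] else set0.
    apply/setP => u; rewrite !inE; have [->|u1] := eqVneq u (f 1).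
      by rewrite inX // sym e1 // !inE (negPf v4) orbF andbT /=; case: ifP; rewrite !inE ?eqxx.
    have [->|u4] := eqVneq u (f 4).
      by rewrite inX // sym e4 // !inE (negPf v1) /=; case: ifP; rewrite !inE ?eqf.
    by rewrite andbF; case: ifP; rewrite !inE ?(negPf u1).
  by case: ifP; rewrite ?cards1 ?cards0.
have admY : admissible (rewire e (f 0) (f 2)) Y.
  apply: rewire_admissible => // [v vY|a b aY bY xa ab by_ ay bx].
    by rewrite degY // (adm_deg adm) //; move: vY; rewrite inE => /andP[].
  (* The leaves are no inner vertices of a path, so a path of three edges between the outer vertices
     passes through two vertices outside [leaf_path] and completes [leaf_pentagon]. *)
  have [aX bX] : a \in X /\ b \in X by move: aY bY; rewrite !inE => /andP[_ ->] /andP[].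
  have a3 : a != f 3.
    by apply: contraTneq ab => ->; rewrite e3 // inE.
  have b5 : b != f 5.
    by apply: contraTneq ab => ->; rewrite sym e5 // inE.
  have a5 : a != f 5.
    by apply: contraTneq xa => ->; rewrite sym e5 ?inX // inE eqf.
  have b3 : b != f 3.
    by apply: contraTneq by_ => ->; rewrite e3 ?inX // inE eqf.
  have ax : a != f 0 by apply: contraTneq xa => ->; rewrite irr.
  have by' : b != f 2 by apply: contraTneq by_ => ->; rewrite irr.
  have ba : b != a by apply: contraTneq ab => ->; rewrite irr.
  move: aY bY; rewrite !inE => /andP[/norP[a1 a4] _] /andP[/norP[b1 b4] _].
  have occ1 : occurs e X (add_fresh leaf_path 0) (extend f 6 a).
    apply: (occurs_add_fresh min _ _ _ occ) => // [|i].
      by rewrite inE aX.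
    by case: i => [|[|[|[|[|[|]]]]]] // _; rewrite eq_sym.
  have occ2 : occurs e X (add_fresh (add_fresh leaf_path 0) 2) (extend (extend f 6 a) 7 b).
    apply: (occurs_add_fresh min _ _ _ occ1) => // [|i].
      by rewrite inE bX sym.
    by case: i => [|[|[|[|[|[|[|]]]]]]] // _; rewrite eq_sym.
  by apply: (ref5 (extend (extend f 6 a) 7 b)); apply: (occurs_add_edge min _ _ _ _ occ2).
have ltY : #|Y| < #|X|.
  apply/proper_card/properP; split; first exact: subsetDl.
  by exists (f 1); rewrite ?inX // !inE eqxx.
have /existsP[I /and4P[sIY /forall_inP indI /forall_inP domI wI]] := min_ih min ltY admY.
case/negP: (min_bad min); apply/existsP; exists (f 4 |: I).
(* The only neighbour of the leaf 4 is the deleted vertex 1, so 4 can be added to any [I] in [Y]. *)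
have I1 : f 1 \notin I by apply/negP => /(subsetP sIY); rewrite !inE eqxx.
have IX u : u \in I -> u \in X by move=> /(subsetP sIY); rewrite inE => /andP[].
have I4 u : u \in I -> ~~ e (f 4) u.
  move=> uI; rewrite e4 ?IX // inE; by apply: contraNneq I1 => <-.
have leafY i : i \in [:: 3; 5] -> f i \in Y.
  by rewrite !inE => /orP[] /eqP->; rewrite inX ?eqf.
have dom3 : f 0 \notin I -> f 3 \in I.
  apply: contraNT => n3; have /exists_inP[u uI] : [exists u in I, rewire e (f 0) (f 2) (f 3) u].
    by apply: domI; rewrite inE n3 leafY.
  by rewrite /rewire /new_edge !eqf // !orbF e3 ?IX // inE => /eqP <-.
have dom5 : f 2 \notin I -> f 5 \in I.
  apply: contraNT => n5; have /exists_inP[u uI] : [exists u in I, rewire e (f 0) (f 2) (f 5) u].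
    by apply: domI; rewrite inE n5 leafY.
  by rewrite /rewire /new_edge !eqf // !orbF e5 ?IX // inE => /eqP <-.
apply/and4P; split.
- by rewrite subUset sub1set inX // (subset_trans sIY) ?subsetDl.
- apply/forall_inP => u; rewrite !inE => /predU1P[->|uI]; apply/forall_inP => v;
    rewrite !inE => /predU1P[->|vI]; rewrite ?irr ?I4 //; first by rewrite sym I4.
  by have /forall_inP/(_ v vI) := indI u uI; rewrite negb_or => /andP[].
- apply/forall_inP => v; rewrite !inE => /andP[/norP[v4 vI] vX].
  have [v1|v1] := eqVneq v (f 1).
    apply/exists_inP; exists (f 4); first by rewrite !inE eqxx.
    by rewrite v1 e1 ?inX // !inE eqxx !orbT.
  have /exists_inP[u uI] : [exists u in I, rewire e (f 0) (f 2) v u].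
    by apply: domI; rewrite !inE vI vX negb_or v1 v4.
  case/orP => [evu|/orP[] /andP[/eqP vE _]].
  + by apply/exists_inP; exists u; rewrite ?inE ?uI ?orbT.
  + apply/exists_inP; exists (f 3); first by rewrite inE dom3 ?orbT // -vE.
    by rewrite vE sym e3 ?inX // inE.
  + apply/exists_inP; exists (f 5); first by rewrite inE dom5 ?orbT // -vE.
    by rewrite vE sym e5 ?inX // inE.
(* The deleted vertices weigh 5 + 9 and no other weight changes: the one added vertex is paid for
   exactly. *)
- have wX : weight e X = weight (rewire e (f 0) (f 2)) Y + 14.
    rewrite /weight (big_setID D) /= addnC; congr (_ + _).
      by apply: eq_bigr => v /degY->.
    have sDX : D \subset X by rewrite subUset !sub1set !inX.
    rewrite (setIidPr sDX) big_setU1 ?inE ?eqf // big_set1 /=.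
    by rewrite (occ_dg occ (i := 1)) // (occ_dg occ (i := 4)).
  have cI : #|f 4 |: I| <= #|I|.+1 by rewrite cardsU1; case: (_ \notin _).
  rewrite wX; apply: (leq_trans (n := 14 * #|I|.+1)); first by rewrite leq_mul2l.
  by rewrite mulnS addnC leq_add2r.
Qed.

Definition pentagon : pattern :=
  [:: (2, [:: 1; 4]); (2, [:: 0; 2]); (3, [:: 1; 3]); (2, [:: 2; 4]); (3, [:: 3; 0])].
Definition pentagon_ext : pattern := add_fresh (add_fresh pentagon 2) 4.
(** The obstruction to the shortening: a common neighbour 7 of 5 and 6, for which the added edge
    between 2 and 6 would close the 4-cycle 2, 5, 7, 6. *)
Definition pentagon_closed : pattern := add_edge (add_fresh pentagon_ext 5) 7 6.

(** There is only one completion: an edge between 2 and 4 would close the 4-cycle 2, 1, 0, 4, and a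
    common outer neighbour of 2 and 4 would close one with 3. *)
Lemma pentagon_extP (T : finType) (e : rel T) (X : {set T}) f : minimal e X ->
  occurs e X pentagon f -> exists f', occurs e X pentagon_ext f'.
Proof.
move=> min occ.
have [//|s1 in1 [f1 occ1]] :=
  @completionsP _ _ _ min pentagon 2 5 1 f occ isT isT isT erefl.
move: in1; rewrite inE => /eqP es1; rewrite {}es1 in occ1.
have [//|s2 in2 [f2 occ2]] :=
  @completionsP _ _ _ min (add_fresh pentagon 2) 4 6 1 f1 occ1 isT isT isT erefl.
by move: in2; rewrite inE => /eqP es2; rewrite {}es2 in occ2; exists f2.
Qed.

(* Delete the vertices 0, 3, 4 of the pentagon and join its vertex 2 to the
   outer neighbour 6 of 4, so that 1 becomes a leaf at 2. The deleted part is
   dominated by 4 if the set of the smaller graph contains 2 and by 3 if not. *)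
Lemma pentagon_refuted (T : finType) (e : rel T) (X : {set T}) : minimal e X ->
  refuted e X pentagon_closed -> refuted e X pentagon.
Proof.
move=> min ref _ /(pentagon_extP min)[f occ]; have adm := min_adm min.
have sym := adm_sym adm; have irr := adm_irr adm.
have inX i : i < 7 -> f i \in X by apply: (occ_in occ).
have eqf i j : i < 7 -> j < 7 -> (f i == f j) = (i == j) by apply: (occ_neq occ).
have e0 u : u \in X -> e (f 0) u = (u \in [:: f 1; f 4]) by apply: (occ_adjE occ).
have e1 u : u \in X -> e (f 1) u = (u \in [:: f 0; f 2]) by apply: (occ_adjE occ).
have e2 u : u \in X -> e (f 2) u = (u \in [:: f 5; f 1; f 3]) by apply: (occ_adjE occ).
have e3 u : u \in X -> e (f 3) u = (u \in [:: f 2; f 4]) by apply: (occ_adjE occ).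
have e4 u : u \in X -> e (f 4) u = (u \in [:: f 6; f 3; f 0]) by apply: (occ_adjE occ).
have nexy : ~~ e (f 2) (f 6) by rewrite e2 ?inX // !inE !eqf.
pose D := f 0 |: (f 3 |: [set f 4]); set Y := X :\: D.
have inY i : i < 7 -> i \notin [:: 0; 3; 4] -> f i \in Y.
  by move=> li; rewrite !inE inX // !eqf // andbT !negb_or => /and3P[-> -> ->].
have xY : f 2 \in Y by apply: inY.
have yY : f 6 \in Y by apply: inY.
have xy : f 2 != f 6 by rewrite eqf.
have YP v : v \in Y -> [/\ v \in X, v != f 0, v != f 3 & v != f 4].
  by rewrite !inE !negb_or -!andbA => /and4P[].
(* Vertices 2 and 6 each lose one deleted neighbour and gain the other; only 1 loses a neighbour,
   namely 0, without compensation. *)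
have degY v : v \in Y -> deg (rewire e (f 2) (f 6)) Y v = deg e X v - (v == f 1).
  move=> vY; rewrite deg_rewire // (deg_nbhdD e X D).
  have [vX v0 v3 v4] := YP v vY.
  have kE : #|nbrs e X v :&: D| = (v == f 1) + ((v == f 2) || (v == f 6)).
    rewrite -sum1_card big_mkcond /= (eq_bigr (fun u => if u \in D then (e v u : nat) else 0)); last first.
      move=> u _; rewrite in_setI inE; have [uD|_] := boolP (u \in D); last by rewrite andbF.
      have -> : u \in X by move: uD; rewrite !inE => /or3P[] /eqP->; apply: inX.
      by rewrite andbT; case: (e v u).
    rewrite -big_mkcond /= /D !big_setU1 ?inE ?eqf // big_set1 /= ?orbF.
    rewrite (sym v (f 0)) (sym v (f 3)) (sym v (f 4)) e0 // e3 // e4 // !inE (negPf v0) (negPf v3) (negPf v4) !orbF.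
    have [->|v1] := eqVneq v (f 1); first by rewrite !eqf.
    by have [->|v2] := eqVneq v (f 2); first by rewrite !eqf.
  by rewrite kE addnCA addKn.
have admY : admissible (rewire e (f 2) (f 6)) Y.
  apply: rewire_admissible => // [v vY|a b aY bY xa ab by_ ay bx].
    rewrite degY //; apply: leq_trans (leq_subr _ _) _.
    by rewrite (adm_deg adm) //; case: (YP v vY).
  have [aX a0 a3 a4] := YP a aY; have [bX b0 b3 b4] := YP b bY.
  (* In [Y] the old neighbours of 2 are 1 and 5, and 1 leads only back to 2. A path to 6 thus goes
     through 5 and yields [pentagon_closed]. *)
  move: xa; rewrite e2 // !inE (negPf a3) orbF => /orP[] /eqP aE; last first.
    by move: ab; rewrite aE e1 // !inE (negPf b0) (negPf bx).
  rewrite {}aE in aY aX a0 a3 a4 ab ay.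
  have b5 : b != f 5 by apply: contraTneq ab => ->; rewrite irr.
  have b6 : b != f 6 by apply: contraTneq by_ => ->; rewrite irr.
  have b1 : b != f 1 by apply: contraTneq by_ => ->; rewrite e1 ?inX // !inE !eqf.
  have occ1 : occurs e X (add_fresh pentagon_ext 5) (extend f 7 b).
    apply: (occurs_add_fresh min _ _ _ occ) => // [|i].
      by rewrite inE bX.
    by case: i => [|[|[|[|[|[|[|]]]]]]] // _; rewrite eq_sym.
  by apply: (ref (extend f 7 b)); apply: (occurs_add_edge min _ _ _ _ occ1).
have ltY : #|Y| < #|X|.
  apply/proper_card/properP; split; first exact: subsetDl.
  by exists (f 0); rewrite ?inX // !inE eqxx.
have /existsP[I /and4P[sIY /forall_inP indI /forall_inP domI wI]] := min_ih min ltY admY.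
have IP u : u \in I -> [/\ u \in X, u != f 0, u != f 3 & u != f 4].
  by move=> /(subsetP sIY)/YP.
have ind' u v : u \in I -> v \in I -> ~~ rewire e (f 2) (f 6) u v.
  by move=> uI vI; have /forall_inP := indI u uI; apply.
(* The added edge keeps 6 out of a set that contains 2; this leaves 4 without a neighbour in [I]. *)
have ind26 : f 2 \in I -> f 6 \notin I.
  by move=> I2; apply/negP => /(ind' _ _ I2); rewrite /rewire /new_edge !eqxx orbT.
(* In the smaller graph 2 is the only neighbour of 1. Once chosen, 1 dominates both 0 and 2. *)
have I1 : f 2 \notin I -> f 1 \in I.
  apply: contraNT => n1.
  have /exists_inP[u uI] : [exists u in I, rewire e (f 2) (f 6) (f 1) u].
    by apply: domI; rewrite inE n1 inY.
  have [uX u0 _ _] := IP u uI.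
  by rewrite /rewire /new_edge !eqf // !orbF e1 // !inE (negPf u0) => /eqP <-.
pose w := if f 2 \in I then f 4 else f 3.
have wX : w \in X by rewrite /w; case: ifP; rewrite inX.
have Iw u : u \in I -> ~~ e w u.
  move=> uI; have [uX u0 u3 u4] := IP u uI; rewrite /w; case: ifP => [I2|/negbT I2].
    rewrite e4 // !inE (negPf u0) (negPf u3) !orbF.
    by apply: contraTneq uI => ->; apply: ind26.
  rewrite e3 // !inE (negPf u4) orbF.
  by apply: contraTneq uI => ->.
case/negP: (min_bad min); apply/existsP; exists (w |: I).
apply/and4P; split.
- by rewrite subUset sub1set wX (subset_trans sIY) ?subsetDl.
- apply/forall_inP => u; rewrite !inE => /predU1P[->|uI]; apply/forall_inP => v;
    rewrite !inE => /predU1P[->|vI]; rewrite ?irr ?Iw //; first by rewrite sym Iw.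
  by have := ind' _ _ uI vI; rewrite negb_or => /andP[].
- apply/forall_inP => v; rewrite !inE => /andP[/norP[vw vI] vX].
  have domw : e v w -> [exists u in w |: I, e v u].
    by move=> evw; apply/exists_inP; exists w; rewrite ?inE ?eqxx.
  have dom_I u : u \in I -> e v u -> [exists u in w |: I, e v u].
    by move=> uI evu; apply/exists_inP; exists u; rewrite ?inE ?uI ?orbT.
  have [vE|v0] := eqVneq v (f 0).
    move: domw (dom_I (f 1)); rewrite /w vE; case: ifP => [_ h _|/negbT/I1 I1' _].
      by apply: h; rewrite e0 ?inX // !inE eqxx orbT.
    by apply; rewrite // e0 ?inX // !inE eqxx.
  have [vE|v3] := eqVneq v (f 3).
    move: vw domw; rewrite /w vE; case: ifP => [_ _|]; last by rewrite eqxx.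
    by apply; rewrite e3 ?inX // !inE eqxx orbT.
  have [vE|v4] := eqVneq v (f 4).
    move: vw domw; rewrite /w vE; case: ifP => [|_ _]; first by rewrite eqxx.
    by apply; rewrite e4 ?inX // !inE eqxx !orbT.
  have vY : v \in Y by rewrite !inE vX !negb_or v0 v3 v4.
  have /exists_inP[u uI] : [exists u in I, rewire e (f 2) (f 6) v u].
    by apply: domI; rewrite inE vI.
  (* A vertex dominated through the added edge is either 2, which 1 now dominates, or 6 with 2
     chosen, and then [w] is its neighbour 4. *)
  case/orP => [|/orP[] /andP[/eqP vE /eqP uE]]; first exact: dom_I.
    rewrite vE in vI; apply: (dom_I _ (I1 vI)).
    by rewrite vE e2 ?inX // !inE eqxx orbT.
  by apply: domw; rewrite /w -uE uI vE sym e4 ?inX // !inE eqxx.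
(* The deleted vertices weigh 6 + 6 + 5, and vertex 1 rises from 6 to 9, so the net loss is 14. *)
- have : weight e X = weight (rewire e (f 2) (f 6)) Y + 14.
    have sDX : D \subset X by rewrite !subUset !sub1set !inX.
    have f1Y : f 1 \in Y by apply: inY.
    have sumE : \sum_(v in Y :\ f 1) wt (deg (rewire e (f 2) (f 6)) Y v) =
                \sum_(v in Y :\ f 1) wt (deg e X v).
      apply: eq_bigr => v; rewrite in_setD1 => /andP[v1 /degY->].
      by rewrite (negPf v1) subn0.
    rewrite /weight (big_setID D) /= (setIidPr sDX) -/Y addnC.
    rewrite !big_setU1 ?inE ?eqf // big_set1 /= !(big_setD1 (f 1) f1Y) /= sumE.
    rewrite degY // eqxx.
    rewrite (occ_dg occ (i := 0)) // (occ_dg occ (i := 1)) // (occ_dg occ (i := 3)) //.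
    rewrite (occ_dg occ (i := 4)) //=.
    by move: (\sum_(v in _ :\ _) _) => k; clear; rewrite /dg /=; lia.
  have cI : #|w |: I| <= #|I|.+1 by rewrite cardsU1; case: (_ \notin _).
  move=> ->; apply: (leq_trans (n := 14 * #|I|.+1)); first by rewrite leq_mul2l.
  by rewrite mulnS addnC leq_add2r.
Qed.

(** * Unavoidable patterns *)

(* These trees were found by a computer search. *)
Definition certs_leaf : seq (pattern * cert) :=
[:: ([:: (1, [::1]); (1, [::0])], Sel [::0]); ([:: (1, [::1]); (2, [::0])], Nbr 1 [::Deg 2 (Sel
[::1]) (Sel [::1]) (Sel [::0])]); ([:: (3, [::1;2]); (1, [::0]); (1, [::0])], Nbr 0 [::Deg 3 (Sel
[::0]) (Sel [::0]) (Sel [::0])]); ([:: (3, [::1;2]); (1, [::0]); (2, [::0])], Nbr 0 [::Deg 3 (Lib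
2 [::0;1;3]) (Sel [::0]) (Nbr 2 [::Sel [::0]; Deg 4 (Lib 1 [::4;2]) (Nbr 3 [::Deg 5 (Deg 6 (Lib 2
[::3;5;6]) (Sel [::0]) (Sel [::0])) (Sel [::0]) (Sel [::0])]) (Sel [::0])])]); (leaf_triangle, Sel
[::0]); (leaf_pentagon, Deg 6 (Sel [::]) (Lib 3 [::0;3;6]) (Deg 7 (Sel [::]) (Lib 3 [::2;5;7])
(Sel [::2;0])))].

(** Indices of [Lib] count through the whole library: 0 to 6 are the patterns of [lib_leaf], with
    [leaf_path] last. [Sel [::]], which never succeeds, fills branches of [Deg] that the known
    neighbours rule out. *)
Definition certs_pentagon : seq (pattern * cert) :=
[:: ([:: (2, [::1;2]); (2, [::0]); (2, [::0])], Nbr 1 [::Sel [::0]; Deg 3 (Lib 1 [::3;1]) (Nbr 2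
[::Deg 4 (Lib 1 [::4;2]) (Nbr 3 [::Sel [::3;0]; Deg 5 (Lib 1 [::5;3]) (Nbr 4 [::Sel [::5;0]; Deg 6
(Lib 1 [::6;4]) (Sel [::4;1]) (Sel [::2])]) (Sel [::1])]) (Sel [::0])]) (Nbr 2 [::Deg 4 (Lib 1
[::4;2]) (Sel [::0]) (Sel [::0])])]); ([:: (2, [::1;2]); (2, [::0;2]); (3, [::1;0])], Nbr 2 [::Deg
3 (Lib 3 [::2;3;1]) (Sel [::0]) (Sel [::0])]); ([:: (3, [::1;2;3]); (2, [::0]); (2, [::0]); (2,
[::0])], Nbr 1 [::Lib 8 [::1;3;0]; Lib 8 [::1;2;0]; Deg 4 (Lib 1 [::4;1]) (Nbr 2 [::Lib 8
[::2;3;0]; Deg 5 (Lib 1 [::5;2]) (Nbr 3 [::Deg 6 (Lib 1 [::6;3]) (Sel [::0]) (Sel [::0])]) (Sel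
[::0])]) (Nbr 2 [::Lib 8 [::2;3;0]; Deg 5 (Lib 1 [::5;2]) (Sel [::0]) (Sel [::0])])]);
(pentagon_closed, Deg 5 (Sel [::]) (Lib 9 [::2;1;3;5]) (Deg 6 (Sel [::]) (Lib 9 [::4;3;0;6]) (Deg
7 (Sel [::]) (Nbr 6 [::Sel [::2]; Nbr 5 [::Deg 9 (Lib 3 [::5;9;7]) (Deg 8 (Lib 3 [::6;8;7]) (Sel
[::6;2]) (Sel [::4])) (Sel [::2])]]) (Nbr 5 [::Sel [::2]; Deg 8 (Sel [::5;4]) (Sel [::2]) (Sel
[::2])]))))].

(** The milestones are, in this order: a lone vertex of degree 1, two adjacent vertices of degree 2,
    two vertices of degree 2 with a common cubic neighbour, a lone vertex of degree 2, a lone cubic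
    vertex. The other patterns, mostly short cycles and paths through vertices of degree 2, are
    auxiliary. *)
Definition certs_main : seq (pattern * cert) :=
[:: ([:: (3, [::1;2]); (3, [::0;3]); (1, [::0]); (1, [::1])], Nbr 0 [::Deg 4 (Lib 2 [::0;2;4])
(Lib 3 [::0;2;4]) (Nbr 1 [::Lib 4 [::0;2;1;4]; Deg 5 (Lib 2 [::1;3;5]) (Lib 3 [::1;3;5]) (Nbr 4
[::Deg 6 (Lib 6 [::1;0;4;3;2;6]) (Deg 7 (Lib 3 [::4;7;6]) (Nbr 5 [::Deg 8 (Lib 3 [::5;8;7]) (Sel
[::5;0]) (Sel [::1]); Deg 8 (Lib 3 [::5;8;6]) (Sel [::5;0]) (Sel [::1]); Deg 8 (Lib 6
[::0;1;5;2;3;8]) (Deg 9 (Lib 3 [::5;9;8]) (Nbr 8 [::Lib 8 [::8;9;5]; Sel [::8;0]; Sel [::8;0]; Deg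
10 (Lib 1 [::10;8]) (Nbr 10 [::Lib 7 [::10;8;7]; Lib 7 [::10;8;6]; Deg 11 (Lib 1 [::11;10]) (Lib 7
[::10;8;11]) (Nbr 11 [::Lib 9 [::11;10;9;7]; Lib 9 [::11;10;9;6]; Lib 11 [::8;10;11;9;5]; Deg 12
(Lib 3 [::11;12;10]) (Lib 9 [::11;10;7;12]) (Sel [::10;1]); Deg 12 (Lib 3 [::11;12;10]) (Lib 9
[::11;10;6;12]) (Sel [::10;1]); Deg 12 (Lib 3 [::11;12;10]) (Deg 13 (Lib 3 [::11;13;10]) (Lib 9
[::11;10;12;13]) (Sel [::10;1])) (Deg 13 (Lib 3 [::11;13;10]) (Sel [::10;1]) (Sel [::10]))])])
(Nbr 9 [::Sel [::9;0]; Sel [::9;0]; Deg 11 (Lib 1 [::11;9]) (Nbr 11 [::Lib 11 [::9;11;10;8;5]; Lib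
7 [::11;9;7]; Lib 7 [::11;9;6]; Deg 12 (Lib 1 [::12;11]) (Lib 7 [::11;9;12]) (Nbr 12 [::Sel
[::11;1]; Sel [::11;1]; Deg 13 (Lib 3 [::12;13;11]) (Sel [::11;1]) (Sel [::11]); Deg 13 (Lib 3
[::12;13;11]) (Lib 9 [::12;11;7;13]) (Sel [::11;1]); Deg 13 (Lib 3 [::12;13;11]) (Lib 9
[::12;11;6;13]) (Sel [::11;1]); Deg 13 (Lib 3 [::12;13;11]) (Deg 14 (Lib 3 [::12;14;11]) (Lib 9
[::12;11;13;14]) (Sel [::11;1])) (Deg 14 (Lib 3 [::12;14;11]) (Sel [::11;1]) (Sel [::11]))])])
(Sel [::5])])]) (Sel [::1])) (Deg 9 (Lib 6 [::0;1;5;2;3;9]) (Sel [::1]) (Sel [::1]))]) (Sel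
[::0])) (Deg 7 (Lib 6 [::1;0;4;3;2;7]) (Sel [::0]) (Sel [::0]))])])]); ([:: (3, [::1]); (1,
[::0])], Nbr 0 [::Deg 2 (Lib 2 [::0;1;2]) (Lib 3 [::0;1;2]) (Deg 3 (Lib 2 [::0;1;3]) (Lib 3
[::0;1;3]) (Nbr 2 [::Lib 4 [::0;1;2;3]; Deg 4 (Lib 12 [::0;2;1;4]) (Deg 5 (Lib 3 [::2;5;4]) (Nbr 3
[::Deg 6 (Lib 12 [::0;3;1;6]) (Deg 7 (Lib 3 [::3;7;6]) (Nbr 4 [::Sel [::4;0]; Sel [::4;0]; Lib 8
[::4;5;2]; Deg 8 (Lib 1 [::8;4]) (Nbr 8 [::Lib 7 [::8;4;7]; Lib 7 [::8;4;6]; Deg 9 (Lib 1 [::9;8])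
(Lib 7 [::8;4;9]) (Nbr 9 [::Lib 9 [::9;8;7;5]; Deg 10 (Lib 3 [::9;10;8]) (Lib 9 [::9;8;7;10]) (Nbr
6 [::Sel [::3]; Sel [::5;0]; Deg 11 (Lib 1 [::11;6]) (Nbr 11 [::Sel [::9;6]; Lib 7 [::11;6;5]; Deg
12 (Lib 1 [::12;11]) (Lib 7 [::11;6;12]) (Nbr 5 [::Sel [::9;6;2]; Sel [::9;2]; Deg 13 (Lib 1
[::13;5]) (Sel [::9;6;2]) (Sel [::9;6;2])])]) (Sel [::3])]); Lib 9 [::9;8;6;5]; Deg 10 (Lib 3
[::9;10;8]) (Lib 9 [::9;8;6;10]) (Nbr 7 [::Sel [::3]; Sel [::5;0]; Deg 11 (Lib 1 [::11;7]) (Nbr 11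
[::Sel [::9;7]; Lib 7 [::11;7;5]; Deg 12 (Lib 1 [::12;11]) (Lib 7 [::11;7;12]) (Nbr 5 [::Sel
[::9;7;2]; Sel [::9;2]; Deg 13 (Lib 1 [::13;5]) (Sel [::9;7;2]) (Sel [::9;7;2])])]) (Sel [::3])]);
Lib 11 [::4;8;9;5;2]; Deg 10 (Lib 3 [::9;10;8]) (Deg 11 (Lib 3 [::9;11;8]) (Lib 9 [::9;8;10;11])
(Sel [::8;0])) (Deg 11 (Lib 3 [::9;11;8]) (Sel [::8;0]) (Sel [::8]))])]) (Nbr 5 [::Sel [::5;0];
Sel [::5;0]; Deg 9 (Lib 1 [::9;5]) (Nbr 9 [::Lib 11 [::5;9;8;4;2]; Lib 7 [::9;5;7]; Lib 7
[::9;5;6]; Deg 10 (Lib 1 [::10;9]) (Lib 7 [::9;5;10]) (Nbr 10 [::Sel [::10;2]; Sel [::10;2]; Deg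
11 (Lib 3 [::10;11;9]) (Sel [::9;0]) (Sel [::9]); Deg 11 (Lib 3 [::10;11;9]) (Lib 9 [::10;9;7;11])
(Nbr 6 [::Sel [::3]; Sel [::3]; Deg 12 (Lib 1 [::12;6]) (Nbr 12 [::Sel [::10;6]; Sel [::10;6;2];
Deg 13 (Lib 1 [::13;12]) (Lib 7 [::12;6;13]) (Sel [::10;6;2])]) (Sel [::3])]); Deg 11 (Lib 3
[::10;11;9]) (Lib 9 [::10;9;6;11]) (Nbr 7 [::Sel [::3]; Sel [::3]; Deg 12 (Lib 1 [::12;7]) (Nbr 12
[::Sel [::10;7]; Sel [::10;7;2]; Deg 13 (Lib 1 [::13;12]) (Lib 7 [::12;7;13]) (Sel [::10;7;2])])
(Sel [::3])]); Deg 11 (Lib 3 [::10;11;9]) (Deg 12 (Lib 3 [::10;12;9]) (Lib 9 [::10;9;11;12]) (Sel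
[::9;0])) (Deg 12 (Lib 3 [::10;12;9]) (Sel [::9;0]) (Sel [::9]))])]) (Sel [::2])])]) (Sel [::0]))
(Deg 7 (Lib 12 [::0;3;1;7]) (Sel [::0]) (Sel [::0]))]) (Nbr 3 [::Deg 6 (Lib 12 [::0;3;1;6]) (Deg 7
(Lib 3 [::3;7;6]) (Sel [::0]) (Sel [::0])) (Sel [::0])])) (Deg 5 (Lib 12 [::0;2;1;5]) (Nbr 3
[::Deg 6 (Lib 12 [::0;3;1;6]) (Deg 7 (Lib 3 [::3;7;6]) (Sel [::0]) (Sel [::0])) (Sel [::0])]) (Nbr
3 [::Deg 6 (Lib 12 [::0;3;1;6]) (Sel [::0]) (Sel [::0])]))]))]); ([:: (1, [::])], Nbr 0 [::Deg 1
(Lib 0 [::0;1]) (Lib 1 [::0;1]) (Lib 13 [::1;0])]); ([:: (3, [::1;2]); (3, [::0;2]); (2,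
[::1;0])], Nbr 0 [::Nbr 1 [::Deg 3 (Lib 3 [::0;3;2]) (Deg 4 (Lib 3 [::1;4;2]) (Sel [::0]) (Sel
[::0])) (Deg 4 (Lib 3 [::1;4;2]) (Sel [::1]) (Sel [::2]))]]); ([:: (3, [::1;4]); (3, [::0;2]); (3,
[::1;3]); (2, [::2;4]); (2, [::3;0])], Nbr 2 [::Deg 5 (Lib 3 [::2;5;3]) (Nbr 0 [::Deg 6 (Lib 3
[::0;6;4]) (Nbr 1 [::Lib 15 [::0;1;6]; Lib 15 [::1;2;5]; Deg 7 (Lib 13 [::1;7]) (Nbr 5 [::Sel
[::2;0]; Deg 8 (Lib 1 [::8;5]) (Sel [::2;0]) (Sel [::2])]) (Sel [::2;0])]) (Sel [::4])]) (Sel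
[::3])]); ([:: (3, [::1;4]); (3, [::0;2]); (2, [::1;3]); (3, [::2;4]); (2, [::3;0])], Nbr 3 [::Deg
5 (Lib 3 [::3;5;2]) (Lib 9 [::3;2;4;5]) (Nbr 5 [::Deg 6 (Lib 13 [::5;6]) (Deg 7 (Lib 3 [::5;7;6])
(Sel [::3]) (Sel [::3])) (Sel [::3])])]); ([:: (3, [::1]); (2, [::0;2]); (3, [::1;3]); (2,
[::2;4]); (3, [::3])], Nbr 2 [::Lib 15 [::2;4;3]; Lib 15 [::0;2;1]; Deg 5 (Lib 3 [::2;5;1]) (Lib 9
[::2;1;3;5]) (Nbr 5 [::Deg 6 (Lib 13 [::5;6]) (Deg 7 (Lib 3 [::5;7;6]) (Sel [::2]) (Sel [::2]))
(Sel [::2])])]); ([:: (3, [::1;5]); (2, [::0;2]); (2, [::1;3]); (3, [::2;4]); (2, [::3;5]); (2,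
[::4;0])], Nbr 3 [::Deg 6 (Lib 3 [::3;6;2]) (Lib 9 [::3;2;4;6]) (Sel [::4;1])]); ([:: (3,
[::1;5]); (3, [::0;2]); (2, [::1;3]); (3, [::2;4]); (2, [::3;5]); (2, [::4;0])], Nbr 3 [::Lib 15
[::1;3;2]; Deg 6 (Lib 3 [::3;6;2]) (Lib 9 [::3;2;4;6]) (Nbr 0 [::Lib 16 [::0;6;3;4;5]; Deg 7 (Lib
3 [::0;7;5]) (Nbr 1 [::Lib 15 [::0;1;7]; Deg 8 (Lib 3 [::1;8;2]) (Sel [::4;1]) (Sel [::3;0])])
(Sel [::5])])]); ([:: (3, [::1;5]); (3, [::0;2]); (3, [::1;3]); (3, [::2;4]); (2, [::3;5]); (2,
[::4;0])], Nbr 3 [::Lib 16 [::0;1;3;4;5]; Deg 6 (Lib 3 [::3;6;4]) (Nbr 0 [::Lib 11 [::4;5;0;6;3];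
Lib 16 [::0;2;3;4;5]; Deg 7 (Lib 3 [::0;7;5]) (Nbr 1 [::Lib 15 [::0;1;7]; Deg 8 (Lib 13 [::1;8])
(Nbr 7 [::Lib 19 [::0;5;4;3;6;7]; Deg 9 (Lib 1 [::9;7]) (Sel [::3;0]) (Sel [::0])]) (Sel
[::3;0])]) (Sel [::5])]) (Sel [::4])]); ([:: (2, [::1]); (2, [::0;2]); (3, [::1;3]); (2, [::2;4]);
(2, [::3])], Nbr 0 [::Lib 7 [::0;1;4]; Lib 8 [::0;1;2]; Deg 5 (Lib 1 [::5;0]) (Lib 7 [::0;1;5])
(Nbr 4 [::Lib 19 [::2;1;0;5;4;3]; Lib 8 [::3;4;2]; Deg 6 (Lib 1 [::6;4]) (Lib 7 [::4;3;6]) (Nbr 2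
[::Deg 7 (Lib 3 [::2;7;1]) (Lib 9 [::2;1;3;7]) (Nbr 5 [::Lib 16 [::2;7;5;0;1]; Lib 16
[::2;7;5;0;1]; Deg 8 (Lib 3 [::5;8;0]) (Nbr 8 [::Lib 20 [::2;7;8;5;0;1]; Lib 15 [::5;6;8]; Deg 9
(Lib 1 [::9;8]) (Nbr 6 [::Lib 16 [::2;7;6;4;3]; Deg 10 (Lib 3 [::6;10;4]) (Sel [::8;4;1]) (Sel
[::4])]) (Nbr 6 [::Lib 16 [::2;7;6;4;3]; Deg 10 (Lib 3 [::6;10;4]) (Nbr 9 [::Lib 17
[::5;6;10;9;8]; Lib 17 [::5;6;10;9;8]; Deg 11 (Lib 3 [::9;11;8]) (Sel [::9;3;0]) (Sel [::8;4;1]);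
Deg 11 (Lib 3 [::9;11;8]) (Deg 12 (Lib 3 [::9;12;8]) (Lib 9 [::9;8;11;12]) (Sel [::8;4;1])) (Deg
12 (Lib 3 [::9;12;8]) (Sel [::8;4;1]) (Sel [::8;4;1]))]) (Sel [::4])])]) (Sel [::0]); Deg 8 (Lib 3
[::5;8;0]) (Deg 9 (Lib 3 [::5;9;0]) (Lib 9 [::5;0;8;9]) (Sel [::3;0])) (Deg 9 (Lib 3 [::5;9;0])
(Sel [::3;0]) (Sel [::0]))])])])]); ([:: (2, [::1]); (2, [::0;2]); (3, [::1;3]); (2, [::2])], Nbr
2 [::Lib 8 [::0;1;2]; Deg 4 (Lib 3 [::2;4;1]) (Lib 9 [::2;1;3;4]) (Nbr 3 [::Lib 15 [::2;4;3]; Deg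
5 (Lib 1 [::5;3]) (Lib 22 [::0;1;2;3;5]) (Nbr 4 [::Deg 6 (Lib 13 [::4;6]) (Deg 7 (Lib 3 [::4;7;6])
(Nbr 0 [::Lib 7 [::0;1;7]; Lib 7 [::0;1;6]; Lib 11 [::0;1;2;3;5]; Deg 8 (Lib 1 [::8;0]) (Lib 7
[::0;1;8]) (Nbr 6 [::Lib 20 [::2;4;6;8;0;1]; Lib 8 [::6;7;4]; Lib 17 [::2;4;6;5;3]; Deg 9 (Lib 1
[::9;6]) (Nbr 9 [::Lib 22 [::1;0;8;9;6]; Lib 20 [::4;2;3;5;9;6]; Deg 10 (Lib 1 [::10;9]) (Lib 7
[::9;6;10]) (Nbr 10 [::Lib 11 [::6;9;10;7;4]; Sel [::9]; Deg 11 (Lib 3 [::10;11;9]) (Sel [::9;2])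
(Sel [::9]); Lib 10 [::6;9;10;7;4;5;2;3]; Lib 11 [::6;9;10;7;4]; Deg 11 (Lib 3 [::10;11;9]) (Nbr 5
[::Lib 15 [::5;10;11]; Lib 20 [::8;5;3;2;1;0]; Lib 17 [::2;4;7;5;3]; Deg 12 (Lib 3 [::5;12;3])
(Sel [::6;5;1]) (Nbr 11 [::Sel [::10]; Lib 19 [::4;6;9;10;11;7]; Deg 13 (Lib 1 [::13;11]) (Lib 22
[::6;9;10;11;13]) (Sel [::10])])]) (Sel [::9]); Deg 11 (Lib 3 [::10;11;9]) (Deg 12 (Lib 3
[::10;12;9]) (Lib 9 [::10;9;11;12]) (Sel [::9;2])) (Deg 12 (Lib 3 [::10;12;9]) (Sel [::9;2]) (Sel
[::9]))])]) (Nbr 7 [::Lib 18 [::8;7;4;6;9]; Lib 17 [::2;4;7;5;3]; Deg 10 (Lib 1 [::10;7]) (Nbr 8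
[::Lib 20 [::8;9;6;4;7;10]; Lib 20 [::8;5;3;2;1;0]; Lib 22 [::1;0;8;10;7]; Lib 20 [::8;5;3;2;1;0];
Deg 11 (Lib 3 [::8;11;0]) (Nbr 9 [::Lib 15 [::8;9;11]; Lib 11 [::7;10;9;6;4]; Nbr 5 [::Lib 20
[::4;2;3;5;10;7]; Deg 12 (Lib 3 [::5;12;3]) (Sel [::5;4]) (Sel [::9;2])]; Deg 12 (Lib 3
[::9;12;6]) (Nbr 12 [::Lib 7 [::10;7;12]; Lib 18 [::2;3;5;12;9]; Deg 13 (Lib 1 [::13;12]) (Sel
[::12;4;0]) (Lib 18 [::4;6;9;12;13])]) (Nbr 11 [::Lib 7 [::10;7;11]; Lib 18 [::2;3;5;11;8]; Deg 13
(Lib 1 [::13;11]) (Lib 22 [::1;0;8;11;13]) (Sel [::8])])]) (Sel [::0]); Lib 20 [::8;5;3;2;1;0];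
Deg 11 (Lib 3 [::8;11;0]) (Deg 12 (Lib 3 [::8;12;0]) (Lib 9 [::8;0;11;12]) (Sel [::4;0])) (Deg 12
(Lib 3 [::8;12;0]) (Sel [::4;0]) (Sel [::0]))]) (Lib 18 [::9;6;4;7;10])])])]) (Sel [::2])) (Deg 7
(Lib 13 [::4;7]) (Sel [::2]) (Sel [::2]))])])]); ([:: (2, [::1]); (2, [::0])], Nbr 0 [::Deg 2 (Lib
1 [::2;0]) (Lib 7 [::0;1;2]) (Nbr 1 [::Lib 8 [::0;1;2]; Deg 3 (Lib 1 [::3;1]) (Lib 7 [::1;0;3])
(Nbr 2 [::Deg 4 (Lib 3 [::2;4;0]) (Lib 23 [::1;0;2;4]) (Deg 5 (Lib 3 [::2;5;0]) (Lib 23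
[::1;0;2;5]) (Sel [::0]))])])]); ([:: (2, [::1]); (3, [::0;2]); (2, [::1])], Nbr 1 [::Deg 3 (Lib 3
[::1;3;0]) (Lib 9 [::1;0;2;3]) (Nbr 0 [::Lib 15 [::1;3;0]; Lib 8 [::0;2;1]; Deg 4 (Lib 1 [::4;0])
(Lib 23 [::4;0;1;2]) (Nbr 2 [::Lib 15 [::1;3;2]; Deg 5 (Lib 1 [::5;2]) (Lib 23 [::5;2;1;0]) (Lib
18 [::4;0;1;2;5])])])]); ([:: (2, [::1]); (3, [::0;2;3]); (3, [::1;3]); (3, [::2;1])], Nbr 0
[::Deg 4 (Lib 1 [::4;0]) (Lib 24 [::0;4]) (Nbr 2 [::Deg 5 (Lib 4 [::2;5;1;3]) (Nbr 3 [::Deg 6 (Lib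
4 [::3;6;2;1]) (Sel [::1]) (Sel [::1])]) (Sel [::1])])]); ([:: (2, [::1]); (3, [::0;2]); (3,
[::1;3;4]); (3, [::2]); (3, [::2])], Nbr 1 [::Lib 26 [::0;1;2;4]; Lib 26 [::0;1;2;3]; Deg 5 (Lib 3
[::1;5;0]) (Lib 25 [::0;1;5]) (Nbr 0 [::Lib 15 [::1;5;0]; Deg 6 (Lib 1 [::6;0]) (Lib 24 [::0;6])
(Nbr 5 [::Deg 7 (Lib 13 [::5;7]) (Deg 8 (Lib 3 [::5;8;7]) (Lib 25 [::7;5;8]) (Sel [::1])) (Deg 8
(Lib 13 [::5;8]) (Sel [::1]) (Sel [::1]))])])]); ([:: (3, [::1;5]); (2, [::0;2]); (3, [::1;3]);
(3, [::2;4]); (2, [::3;5]); (3, [::4;0])], Nbr 3 [::Lib 15 [::3;5;4]; Deg 6 (Lib 3 [::3;6;4]) (Lib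
25 [::4;3;6]) (Nbr 5 [::Deg 7 (Lib 3 [::5;7;4]) (Lib 25 [::4;5;7]) (Nbr 0 [::Lib 26 [::1;0;5;7];
Nbr 6 [::Deg 8 (Lib 13 [::6;8]) (Sel [::3;0]) (Lib 27 [::1;0;6;3;8])]; Lib 15 [::0;2;1]; Deg 8
(Lib 3 [::0;8;1]) (Lib 25 [::1;0;8]) (Nbr 2 [::Sel [::5;2]; Lib 26 [::1;2;3;6]; Deg 9 (Lib 3
[::2;9;1]) (Lib 25 [::1;2;9]) (Sel [::4;1])])])])]); ([:: (3, [::1;5]); (3, [::0;2]); (2,
[::1;3]); (3, [::2;4]); (3, [::3;5]); (3, [::4;0])], Nbr 1 [::Lib 26 [::2;1;0;5]; Lib 15
[::1;3;2]; Deg 6 (Lib 3 [::1;6;2]) (Lib 25 [::2;1;6]) (Nbr 0 [::Lib 26 [::2;1;0;6]; Lib 27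
[::2;1;0;5;4]; Deg 7 (Lib 13 [::0;7]) (Nbr 3 [::Lib 17 [::0;1;2;3;7]; Lib 26 [::2;3;4;5]; Deg 8
(Lib 3 [::3;8;2]) (Lib 25 [::2;3;8]) (Nbr 4 [::Lib 26 [::2;3;4;8]; Lib 27 [::2;3;4;5;6]; Deg 9
(Lib 13 [::4;9]) (Nbr 5 [::Lib 15 [::4;5;9]; Lib 15 [::0;5;7]; Deg 10 (Lib 13 [::5;10]) (Nbr 7
[::Lib 16 [::0;5;4;9;7]; Lib 28 [::0;7;8;3;2;1]; Deg 11 (Lib 1 [::11;7]) (Lib 24 [::7;11]) (Nbr 8
[::Lib 28 [::0;7;11;8;10;5]; Lib 27 [::2;3;8;11;6]; Deg 12 (Lib 13 [::8;12]) (Sel [::3;0]) (Lib 27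
[::2;3;8;11;12]); Nbr 6 [::Lib 27 [::2;1;6;8;11]; Lib 28 [::1;2;3;4;9;6]; Deg 12 (Lib 13 [::6;12])
(Sel [::8;4;1]) (Lib 27 [::2;1;6;8;12])]; Deg 12 (Lib 3 [::8;12;10]) (Lib 25 [::10;8;12]) (Sel
[::3;0]); Deg 12 (Lib 13 [::8;12]) (Sel [::3;0]) (Lib 27 [::2;3;8;6;12]); Deg 12 (Lib 13 [::8;12])
(Deg 13 (Lib 3 [::8;13;12]) (Lib 25 [::12;8;13]) (Sel [::3;0])) (Sel [::3;0])])]) (Lib 27
[::7;0;5;4;10])]) (Lib 27 [::2;3;4;5;9])])]) (Lib 27 [::2;1;0;5;7])])]); ([:: (3, [::6;1;5]); (3,
[::0;2]); (3, [::1;3]); (3, [::2;4]); (3, [::3;5]); (3, [::4;0]); (2, [::0])], Nbr 1 [::Lib 15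
[::0;1;6]; Lib 26 [::6;0;1;5]; Lib 27 [::6;0;1;2;3]; Deg 7 (Lib 13 [::1;7]) (Nbr 5 [::Lib 15
[::0;5;6]; Lib 27 [::6;0;5;4;3]; Deg 8 (Lib 13 [::5;8]) (Nbr 2 [::Nbr 3 [::Lib 28 [::0;6;3;2;8;5];
Deg 9 (Lib 13 [::3;9]) (Nbr 4 [::Lib 15 [::3;4;9]; Lib 28 [::1;7;4;5;8;2]; Deg 10 (Lib 13
[::4;10]) (Nbr 10 [::Lib 21 [::1;0;5;4;10;7]; Lib 16 [::0;5;4;10;6]; Deg 11 (Lib 1 [::11;10]) (Lib
24 [::10;11]) (Nbr 11 [::Lib 9 [::11;10;9;7]; Lib 9 [::11;10;9;6]; Lib 17 [::3;4;10;11;9]; Lib 9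
[::11;10;7;6]; Lib 18 [::1;7;11;10;4]; Lib 18 [::0;6;11;10;4]; Deg 12 (Lib 3 [::11;12;10]) (Lib 25
[::10;11;12]) (Deg 13 (Lib 3 [::11;13;10]) (Lib 25 [::10;11;13]) (Nbr 6 [::Sel [::10;2;0]; Sel
[::10;2;0]; Lib 21 [::0;1;2;3;9;6]; Deg 14 (Lib 1 [::14;6]) (Lib 24 [::6;14]) (Sel
[::10;2;0])]))])]) (Lib 27 [::8;5;4;3;10])]) (Lib 27 [::8;2;3;4;9])]; Lib 15 [::1;2;7]; Lib 27
[::7;1;2;3;4]; Deg 9 (Lib 13 [::2;9]) (Nbr 3 [::Lib 15 [::2;3;9]; Nbr 4 [::Lib 15 [::4;5;8]; Lib
28 [::0;6;3;4;7;1]; Deg 10 (Lib 13 [::4;10]) (Nbr 10 [::Lib 16 [::2;3;4;10;9]; Lib 21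
[::1;0;5;4;10;7]; Deg 11 (Lib 1 [::11;10]) (Lib 24 [::10;11]) (Nbr 11 [::Lib 9 [::11;10;9;8]; Lib
9 [::11;10;9;7]; Lib 18 [::2;9;11;10;4]; Lib 9 [::11;10;8;7]; Lib 17 [::4;5;8;11;10]; Lib 18
[::1;7;11;10;4]; Deg 12 (Lib 3 [::11;12;10]) (Lib 25 [::10;11;12]) (Deg 13 (Lib 3 [::11;13;10])
(Lib 25 [::10;11;13]) (Nbr 9 [::Sel [::10;2;0]; Sel [::10;2;0]; Lib 21 [::2;1;0;5;8;9]; Deg 14
(Lib 1 [::14;9]) (Lib 24 [::9;14]) (Sel [::10;2;0])]))])]) (Lib 27 [::6;3;4;5;10])]; Deg 10 (Lib
13 [::3;10]) (Nbr 4 [::Lib 15 [::3;4;10]; Lib 15 [::4;5;8]; Nbr 9 [::Lib 21 [::2;1;0;5;8;9]; Lib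
16 [::0;1;2;9;6]; Deg 11 (Lib 1 [::11;9]) (Lib 24 [::9;11]) (Nbr 11 [::Lib 9 [::11;9;10;8]; Lib 9
[::11;9;10;6]; Lib 17 [::2;3;10;11;9]; Lib 9 [::11;9;8;6]; Lib 18 [::2;9;11;8;5]; Lib 18
[::0;6;11;9;2]; Deg 12 (Lib 3 [::11;12;9]) (Lib 25 [::9;11;12]) (Deg 13 (Lib 3 [::11;13;9]) (Lib
25 [::9;11;13]) (Nbr 6 [::Sel [::9;4;0]; Sel [::9;4;0]; Lib 21 [::0;1;2;3;10;6]; Deg 14 (Lib 1
[::14;6]) (Lib 24 [::6;14]) (Sel [::9;4;0])]))])]; Deg 11 (Lib 13 [::4;11]) (Nbr 6 [::Lib 16
[::0;5;4;11;6]; Lib 21 [::0;1;2;3;10;6]; Lib 16 [::0;1;2;9;6]; Deg 12 (Lib 1 [::12;6]) (Lib 24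
[::6;12]) (Nbr 10 [::Lib 18 [::0;6;12;10;3]; Lib 16 [::3;4;5;8;10]; Lib 16 [::1;2;3;10;7]; Deg 13
(Lib 1 [::13;10]) (Lib 24 [::10;13]) (Sel [::3;0])])]) (Lib 27 [::8;5;4;3;11])]) (Lib 27
[::9;2;3;4;10])]) (Lib 27 [::7;1;2;3;9])]) (Lib 27 [::6;0;5;4;8])]) (Lib 27 [::6;0;1;2;7])]); ([::
(3, [::1;4]); (2, [::0;2]); (3, [::1;3]); (3, [::2;4]); (3, [::3;0])], Nbr 0 [::Nbr 2 [::Deg 5
(Lib 3 [::0;5;1]) (Lib 25 [::1;0;5]) (Nbr 4 [::Lib 26 [::1;0;4;5]; Deg 7 (Lib 13 [::4;7]) (Deg 6
(Lib 3 [::2;6;1]) (Lib 25 [::1;2;6]) (Nbr 3 [::Lib 15 [::3;4;7]; Lib 26 [::1;2;3;6]; Deg 8 (Lib 13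
[::3;8]) (Nbr 5 [::Lib 28 [::0;1;2;3;8;5]; Lib 28 [::0;1;2;3;8;5]; Lib 30 [::0;4;3;2;6;5;1]; Deg 9
(Lib 13 [::5;9]) (Deg 10 (Lib 3 [::5;10;9]) (Lib 25 [::9;5;10]) (Nbr 8 [::Lib 29 [::4;3;8;10;5;0];
Lib 21 [::3;4;0;5;9;8]; Deg 11 (Lib 1 [::11;8]) (Lib 24 [::8;11]) (Sel [::3;0])])) (Deg 10 (Lib 13
[::5;10]) (Nbr 8 [::Lib 21 [::3;4;0;5;10;8]; Lib 29 [::4;3;8;9;5;0]; Deg 11 (Lib 1 [::11;8]) (Lib
24 [::8;11]) (Sel [::3;0])]) (Lib 27 [::1;0;5;9;10]))]) (Lib 27 [::1;2;3;4;8])])) (Lib 27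
[::1;0;4;3;7])])]]); ([:: (3, [::5;1;4]); (3, [::0;2]); (3, [::1;3]); (3, [::2;4]); (3, [::3;0]);
(2, [::0])], Nbr 1 [::Lib 15 [::0;1;5]; Deg 6 (Lib 13 [::1;6]) (Nbr 4 [::Lib 15 [::0;4;5]; Deg 7
(Lib 13 [::4;7]) (Nbr 2 [::Lib 15 [::1;2;6]; Deg 8 (Lib 13 [::2;8]) (Nbr 3 [::Lib 15 [::2;3;8];
Lib 15 [::3;4;7]; Deg 9 (Lib 13 [::3;9]) (Nbr 5 [::Lib 16 [::0;4;3;9;5]; Lib 16 [::0;1;2;8;5]; Deg
10 (Lib 1 [::10;5]) (Lib 24 [::5;10]) (Nbr 10 [::Lib 9 [::10;5;9;8]; Lib 9 [::10;5;9;7]; Lib 9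
[::10;5;9;6]; Lib 18 [::0;5;10;9;3]; Lib 9 [::10;5;8;7]; Lib 9 [::10;5;8;6]; Lib 18
[::0;5;10;8;2]; Lib 9 [::10;5;7;6]; Lib 17 [::0;4;7;10;5]; Lib 17 [::0;1;6;10;5]; Deg 11 (Lib 3
[::10;11;5]) (Lib 25 [::5;10;11]) (Deg 12 (Lib 3 [::10;12;5]) (Lib 25 [::5;10;12]) (Nbr 7 [::Lib
28 [::0;5;10;12;7;4]; Lib 28 [::0;5;10;11;7;4]; Lib 16 [::2;3;4;7;8]; Lib 16 [::1;0;4;7;6]; Deg 13
(Lib 1 [::13;7]) (Lib 24 [::7;13]) (Nbr 13 [::Lib 17 [::3;4;7;13;9]; Lib 18 [::2;8;13;7;4]; Lib 18
[::1;6;13;7;4]; Deg 14 (Lib 3 [::13;14;7]) (Lib 25 [::7;13;14]) (Nbr 12 [::Lib 26 [::7;13;12;14];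
Lib 26 [::5;10;11;12]; Lib 28 [::3;9;12;13;7;4]; Nbr 9 [::Lib 28 [::3;9;14;13;7;4]; Sel
[::12;3;0]; Lib 16 [::1;2;3;9;6]; Deg 15 (Lib 1 [::15;9]) (Lib 24 [::9;15]) (Sel [::12;3;0])]; Lib
28 [::0;5;10;12;6;1]; Deg 15 (Lib 13 [::12;15]) (Nbr 15 [::Lib 24 [::9;15]; Lib 24 [::8;15]; Lib
24 [::6;15]; Deg 16 (Lib 1 [::16;15]) (Lib 24 [::15;16]) (Nbr 16 [::Lib 30
[::10;11;16;14;13;12;5]; Lib 18 [::3;9;16;15;12]; Lib 18 [::2;8;16;15;12]; Lib 18
[::1;6;16;15;12]; Lib 31 [::12;15;16;14;13]; Lib 18 [::3;9;16;15;12]; Lib 18 [::2;8;16;15;12]; Lib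
18 [::1;6;16;15;12]; Lib 31 [::12;15;16;11;10]; Lib 9 [::16;15;9;8]; Lib 9 [::16;15;9;6]; Lib 18
[::3;9;16;15;12]; Lib 9 [::16;15;8;6]; Lib 18 [::2;8;16;15;12]; Lib 18 [::1;6;16;15;12]; Deg 17
(Lib 3 [::16;17;15]) (Lib 25 [::15;16;17]) (Deg 18 (Lib 3 [::16;18;15]) (Lib 25 [::15;16;18]) (Sel
[::15;7;5]))])]) (Lib 27 [::5;10;12;13;15])]); Lib 17 [::3;4;7;13;9]; Lib 18 [::2;8;13;7;4]; Lib
18 [::1;6;13;7;4]; Deg 14 (Lib 3 [::13;14;7]) (Lib 25 [::7;13;14]) (Nbr 11 [::Lib 26
[::7;13;11;14]; Lib 26 [::5;10;11;12]; Lib 28 [::3;9;11;13;7;4]; Nbr 9 [::Lib 28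
[::3;9;14;13;7;4]; Sel [::11;3;0]; Lib 16 [::1;2;3;9;6]; Deg 15 (Lib 1 [::15;9]) (Lib 24 [::9;15])
(Sel [::11;3;0])]; Lib 28 [::0;5;10;11;6;1]; Deg 15 (Lib 13 [::11;15]) (Nbr 15 [::Lib 24 [::9;15];
Lib 24 [::8;15]; Lib 24 [::6;15]; Deg 16 (Lib 1 [::16;15]) (Lib 24 [::15;16]) (Nbr 16 [::Lib 30
[::10;11;13;14;16;12;5]; Lib 18 [::3;9;16;15;11]; Lib 18 [::2;8;16;15;11]; Lib 18
[::1;6;16;15;11]; Lib 31 [::11;15;16;14;13]; Lib 18 [::3;9;16;15;11]; Lib 18 [::2;8;16;15;11]; Lib
18 [::1;6;16;15;11]; Lib 31 [::11;15;16;12;10]; Lib 9 [::16;15;9;8]; Lib 9 [::16;15;9;6]; Lib 18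
[::3;9;16;15;11]; Lib 9 [::16;15;8;6]; Lib 18 [::2;8;16;15;11]; Lib 18 [::1;6;16;15;11]; Deg 17
(Lib 3 [::16;17;15]) (Lib 25 [::15;16;17]) (Deg 18 (Lib 3 [::16;18;15]) (Lib 25 [::15;16;18]) (Sel
[::15;7;5]))])]) (Lib 27 [::5;10;11;13;15])]); Lib 9 [::13;7;9;8]; Lib 9 [::13;7;9;6]; Lib 17
[::3;4;7;13;9]; Lib 9 [::13;7;8;6]; Lib 18 [::2;8;13;7;4]; Lib 18 [::1;6;13;7;4]; Deg 14 (Lib 3
[::13;14;7]) (Lib 25 [::7;13;14]) (Deg 15 (Lib 3 [::13;15;7]) (Lib 25 [::7;13;15]) (Nbr 8 [::Nbr
14 [::Lib 26 [::7;13;14;15]; Lib 26 [::7;13;14;15]; Lib 26 [::7;13;14;15]; Lib 26 [::6;14;13;15];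
Lib 26 [::7;13;14;15]; Lib 28 [::3;9;14;13;7;4]; Sel [::14;4;2]; Deg 16 (Lib 13 [::14;16]) (Sel
[::13;2;0]) (Lib 27 [::7;13;14;12;16]); Lib 28 [::3;9;14;13;7;4]; Sel [::14;4;2]; Deg 16 (Lib 13
[::14;16]) (Sel [::13;2;0]) (Lib 27 [::7;13;14;11;16]); Lib 18 [::1;6;14;9;3]; Lib 28
[::3;9;14;13;7;4]; Deg 16 (Lib 3 [::14;16;6]) (Lib 25 [::6;14;16]) (Sel [::7;6;5]); Deg 16 (Lib 13
[::14;16]) (Deg 17 (Lib 3 [::14;17;16]) (Lib 25 [::16;14;17]) (Sel [::13;2;0])) (Deg 17 (Lib 13
[::14;17]) (Sel [::13;2;0]) (Lib 27 [::7;13;14;16;17]))]; Nbr 14 [::Lib 26 [::7;13;14;15]; Nbr 15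
[::Lib 28 [::3;9;15;13;7;4]; Lib 30 [::10;11;15;13;14;12;5]; Lib 30 [::10;11;15;13;14;12;5]; Lib
18 [::1;6;15;9;3]; Lib 28 [::3;9;15;13;7;4]; Sel [::14;4;1]; Deg 16 (Lib 13 [::15;16]) (Sel
[::13;2;0]) (Sel [::13;2;0])]; Nbr 15 [::Lib 28 [::3;9;15;13;7;4]; Lib 30 [::10;11;14;13;15;12;5];
Lib 30 [::10;11;14;13;15;12;5]; Lib 18 [::1;6;15;9;3]; Lib 28 [::3;9;15;13;7;4]; Sel [::14;4;1];
Deg 16 (Lib 13 [::15;16]) (Sel [::13;2;0]) (Sel [::13;2;0])]; Lib 17 [::2;3;9;14;8]; Lib 17
[::1;2;8;14;6]; Deg 16 (Lib 3 [::14;16;8]) (Lib 25 [::8;14;16]) (Nbr 15 [::Lib 28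
[::3;9;15;13;7;4]; Sel [::13;2;0]; Sel [::13;2;0]; Lib 28 [::3;9;15;13;7;4]; Sel [::13;2;0]; Sel
[::13;2;0]; Lib 18 [::1;6;15;9;3]; Lib 28 [::3;9;15;13;7;4]; Deg 17 (Lib 3 [::15;17;6]) (Lib 25
[::6;15;17]) (Sel [::13;2;0]); Deg 17 (Lib 13 [::15;17]) (Sel [::13;2;0]) (Sel [::13;2;0])])]; Nbr
11 [::Lib 26 [::5;10;11;12]; Sel [::11;2;0]; Lib 28 [::0;5;10;11;6;1]; Deg 16 (Lib 13 [::11;16])
(Sel [::10;4;2]) (Lib 27 [::5;10;11;15;16]); Lib 26 [::5;10;11;12]; Sel [::11;2;0]; Lib 28
[::0;5;10;11;6;1]; Deg 16 (Lib 13 [::11;16]) (Sel [::10;4;2]) (Lib 27 [::5;10;11;14;16]); Lib 26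
[::5;10;11;12]; Lib 26 [::5;10;11;12]; Lib 26 [::5;10;11;12]; Lib 18 [::1;6;11;9;3]; Deg 16 (Lib 3
[::11;16;9]) (Lib 25 [::9;11;16]) (Sel [::9;7;5]); Lib 28 [::0;5;10;11;6;1]; Deg 16 (Lib 13
[::11;16]) (Deg 17 (Lib 3 [::11;17;16]) (Lib 25 [::16;11;17]) (Sel [::10;4;2])) (Deg 17 (Lib 13
[::11;17]) (Sel [::10;4;2]) (Lib 27 [::5;10;11;16;17]))]; Nbr 11 [::Nbr 15 [::Lib 26
[::7;13;14;15]; Lib 28 [::2;8;11;15;9;3]; Lib 28 [::1;6;15;11;8;2]; Deg 16 (Lib 13 [::15;16]) (Sel
[::11;3;0]) (Lib 27 [::7;13;15;11;16])]; Nbr 9 [::Lib 28 [::3;9;15;13;7;4]; Lib 28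
[::2;8;11;14;9;3]; Sel [::11;3;0]; Lib 16 [::1;2;3;9;6]; Deg 16 (Lib 1 [::16;9]) (Lib 24 [::9;16])
(Sel [::11;3;0])]; Lib 26 [::5;10;11;12]; Lib 17 [::2;3;9;11;8]; Lib 17 [::1;2;8;11;6]; Deg 16
(Lib 3 [::11;16;8]) (Lib 25 [::8;11;16]) (Nbr 12 [::Sel [::12;2;0]; Lib 28 [::0;5;10;12;6;1]; Sel
[::10;4;2]; Sel [::12;2;0]; Lib 28 [::0;5;10;12;6;1]; Sel [::10;4;2]; Lib 18 [::1;6;12;9;3]; Deg
17 (Lib 3 [::12;17;9]) (Lib 25 [::9;12;17]) (Sel [::10;4;2]); Lib 28 [::0;5;10;12;6;1]; Deg 17
(Lib 13 [::12;17]) (Sel [::10;4;2]) (Sel [::10;4;2])])]; Deg 16 (Lib 1 [::16;8]) (Lib 24 [::8;16])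
(Sel [::7;5;2])]))])]))])]) (Lib 27 [::7;4;3;2;9])]) (Lib 27 [::6;1;2;3;8])]) (Lib 27
[::5;0;4;3;7])]) (Lib 27 [::5;0;1;2;6])]); ([:: (3, [::1;6]); (2, [::0;2]); (3, [::1;3]); (3,
[::2;4]); (2, [::3;5]); (3, [::4;6]); (3, [::5;0])], Nbr 0 [::Lib 26 [::1;0;6;5]; Lib 15
[::0;2;1]; Nbr 5 [::Lib 15 [::3;5;4]; Nbr 2 [::Deg 8 (Sel [::]) (Lib 17 [::2;3;4;5;8]) (Lib 29
[::6;0;1;2;8;5]); Nbr 3 [::Deg 9 (Sel [::]) (Lib 15 [::2;3;9]) (Lib 26 [::1;2;3;9]); Deg 7 (Sel
[::]) (Lib 17 [::2;3;7;0;1]) (Lib 29 [::6;5;4;3;7;0]); Deg 7 (Lib 3 [::0;7;1]) (Lib 25 [::1;0;7])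
(Nbr 6 [::Deg 10 (Sel [::]) (Lib 17 [::5;6;10;3;4]) (Lib 27 [::1;0;6;5;10]); Deg 9 (Sel [::]) (Lib
17 [::0;6;9;2;1]) (Lib 27 [::1;0;6;5;9]); Deg 8 (Sel [::]) (Lib 15 [::5;6;8]) (Lib 26
[::4;5;6;8]); Lib 26 [::1;0;6;7]; Deg 11 (Lib 13 [::6;11]) (Nbr 11 [::Deg 10 (Sel [::]) (Lib 20
[::6;5;4;3;10;11]) (Lib 28 [::3;4;5;6;11;10]); Deg 9 (Sel [::]) (Lib 20 [::6;0;1;2;9;11]) (Lib 28
[::0;1;2;9;11;6]); Deg 12 (Lib 1 [::12;11]) (Lib 24 [::11;12]) (Deg 8 (Lib 3 [::5;8;4]) (Lib 25
[::4;5;8]) (Deg 9 (Lib 3 [::2;9;1]) (Lib 25 [::1;2;9]) (Deg 10 (Lib 3 [::3;10;4]) (Lib 25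
[::4;3;10]) (Nbr 12 [::Lib 32 [::2;3;10;12;9;1]; Lib 29 [::8;5;4;3;10;12]; Lib 31 [::6;11;12;7;0];
Deg 13 (Lib 3 [::12;13;11]) (Lib 25 [::11;12;13]) (Nbr 10 [::Lib 26 [::11;12;10;13]; Lib 27
[::4;3;10;12;8]; Lib 27 [::4;3;10;12;7]; Deg 14 (Lib 13 [::10;14]) (Nbr 7 [::Lib 29
[::0;6;11;12;13;7]; Lib 29 [::3;10;14;7;9;2]; Lib 32 [::0;6;5;8;7;1]; Deg 15 (Lib 3 [::7;15;14])
(Lib 25 [::14;7;15]) (Nbr 8 [::Lib 27 [::4;5;8;15;13]; Lib 27 [::4;5;8;15;9]; Lib 30
[::0;6;5;8;15;7;1]; Lib 27 [::4;5;8;13;9]; Lib 29 [::5;6;11;12;13;8]; Lib 29 [::2;3;4;5;8;9]; Deg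
16 (Lib 13 [::8;16]) (Deg 17 (Lib 3 [::8;17;16]) (Lib 25 [::16;8;17]) (Nbr 16 [::Lib 15
[::8;17;16]; Nbr 15 [::Lib 29 [::12;10;14;7;15;13]; Lib 29 [::7;0;1;2;9;15]; Deg 18 (Lib 3
[::15;18;16]) (Lib 25 [::16;15;18]) (Sel [::16;14;4])]; Nbr 17 [::Lib 27 [::16;8;17;15;9]; Deg 18
(Lib 13 [::17;18]) (Sel [::8;3]) (Lib 27 [::16;8;17;15;18]); Deg 18 (Lib 13 [::17;18]) (Sel
[::8;3;0]) (Lib 27 [::16;8;17;9;18]); Deg 18 (Lib 13 [::17;18]) (Deg 19 (Lib 3 [::17;19;18]) (Lib
25 [::18;17;19]) (Sel [::8;3])) (Sel [::8;3;0])]; Nbr 9 [::Lib 29 [::7;0;1;2;9;15]; Lib 30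
[::2;3;10;12;13;9;1]; Deg 18 (Lib 3 [::9;18;16]) (Lib 25 [::16;9;18]) (Nbr 18 [::Lib 27
[::16;9;18;17;15]; Lib 27 [::16;9;18;17;13]; Lib 31 [::8;16;9;18;17]; Lib 27 [::16;9;18;15;13];
Sel [::10;9;5]; Deg 19 (Lib 13 [::18;19]) (Sel [::9;0]) (Lib 27 [::16;9;18;13;19]); Deg 19 (Lib 13
[::18;19]) (Deg 20 (Lib 3 [::18;20;19]) (Lib 25 [::19;18;20]) (Sel [::9;0])) (Sel [::10;9;0])])];
Deg 18 (Lib 1 [::18;16]) (Lib 24 [::16;18]) (Nbr 17 [::Lib 27 [::16;8;17;15;13]; Lib 27
[::16;8;17;15;9]; Sel [::11;8;3]; Lib 27 [::16;8;17;13;9]; Sel [::8;3;0]; Deg 19 (Lib 13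
[::17;19]) (Sel [::8;3;0]) (Lib 27 [::16;8;17;9;19]); Deg 19 (Lib 13 [::17;19]) (Deg 20 (Lib 3
[::17;20;19]) (Lib 25 [::19;17;20]) (Sel [::8;3])) (Sel [::8;3;0])])])) (Deg 17 (Lib 13 [::8;17])
(Nbr 16 [::Lib 15 [::8;16;17]; Lib 15 [::8;16;17]; Lib 15 [::8;16;17]; Lib 15 [::8;16;17]; Lib 27
[::17;8;16;15;13]; Lib 27 [::17;8;16;15;9]; Deg 18 (Lib 13 [::16;18]) (Nbr 17 [::Sel [::8;3]; Sel
[::11;8;3]; Deg 19 (Lib 1 [::19;17]) (Lib 24 [::17;19]) (Sel [::8;3])]) (Lib 27
[::17;8;16;15;18]); Lib 27 [::17;8;16;13;9]; Deg 18 (Lib 13 [::16;18]) (Nbr 17 [::Sel [::8;3]; Sel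
[::8;3;0]; Deg 19 (Lib 1 [::19;17]) (Lib 24 [::17;19]) (Sel [::8;3])]) (Lib 27 [::17;8;16;13;18]);
Deg 18 (Lib 13 [::16;18]) (Nbr 9 [::Lib 15 [::9;16;18]; Lib 27 [::1;2;9;16;15]; Lib 27
[::1;2;9;16;13]; Deg 19 (Lib 13 [::9;19]) (Nbr 19 [::Lib 16 [::8;16;9;19;17]; Sel [::10;9;0]; Sel
[::9;0]; Deg 20 (Lib 1 [::20;19]) (Lib 24 [::19;20]) (Sel [::9;0])]) (Lib 27 [::1;2;9;16;19])])
(Lib 27 [::17;8;16;9;18]); Deg 18 (Lib 13 [::16;18]) (Deg 19 (Lib 3 [::16;19;18]) (Lib 25
[::18;16;19]) (Nbr 17 [::Sel [::8;3]; Sel [::8;3]; Sel [::8;3;0]; Deg 20 (Lib 1 [::20;17]) (Lib 24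
[::17;20]) (Sel [::8;3])])) (Deg 19 (Lib 13 [::16;19]) (Nbr 17 [::Sel [::8;3]; Sel [::8;3]; Sel
[::8;3;0]; Deg 20 (Lib 1 [::20;17]) (Lib 24 [::17;20]) (Sel [::8;3])]) (Lib 27
[::17;8;16;18;19]))]) (Lib 27 [::4;5;8;16;17]))]); Lib 27 [::1;0;7;13;9]; Lib 27 [::1;0;7;13;8];
Lib 29 [::0;6;11;12;13;7]; Lib 27 [::1;0;7;9;8]; Lib 31 [::0;1;2;9;7]; Lib 32 [::0;6;5;8;7;1]; Deg
15 (Lib 13 [::7;15]) (Deg 16 (Lib 3 [::7;16;15]) (Lib 25 [::15;7;16]) (Nbr 13 [::Lib 27
[::11;12;13;16;9]; Lib 27 [::11;12;13;16;8]; Deg 17 (Lib 13 [::13;17]) (Nbr 16 [::Lib 15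
[::13;16;17]; Lib 15 [::7;16;15]; Lib 31 [::10;14;16;13;12]; Lib 27 [::15;7;16;13;9]; Lib 27
[::15;7;16;13;8]; Deg 18 (Lib 13 [::16;18]) (Nbr 18 [::Lib 21 [::10;12;13;16;18;14]; Nbr 9 [::Lib
17 [::13;16;18;9;17]; Lib 17 [::7;16;18;9;15]; Lib 18 [::10;14;9;18;16]; Lib 29 [::2;3;4;5;8;9];
Deg 19 (Lib 3 [::9;19;18]) (Lib 25 [::18;9;19]) (Sel [::18;3;0])]; Sel [::16;11;1]; Deg 19 (Lib 1
[::19;18]) (Lib 24 [::18;19]) (Sel [::16;11;1])]) (Lib 27 [::15;7;16;13;18])]) (Lib 27
[::11;12;13;16;17]); Lib 30 [::2;3;10;12;13;9;1]; Lib 29 [::5;6;11;12;13;8]; Deg 17 (Lib 3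
[::13;17;15]) (Lib 25 [::15;13;17]) (Sel [::15;11;1]); Lib 27 [::11;12;13;9;8]; Lib 30
[::2;3;10;12;13;9;1]; Lib 29 [::5;6;11;12;13;8]; Deg 17 (Lib 13 [::13;17]) (Deg 18 (Lib 3
[::13;18;17]) (Lib 25 [::17;13;18]) (Sel [::12;0])) (Deg 18 (Lib 13 [::13;18]) (Sel [::12;0]) (Lib
27 [::11;12;13;17;18]))])) (Deg 16 (Lib 13 [::7;16]) (Nbr 13 [::Lib 30 [::2;3;10;12;13;9;1]; Lib
29 [::5;6;11;12;13;8]; Deg 17 (Lib 3 [::13;17;16]) (Lib 25 [::16;13;17]) (Sel [::16;11;1]); Lib 27
[::11;12;13;15;9]; Lib 27 [::11;12;13;15;8]; Deg 17 (Lib 13 [::13;17]) (Nbr 15 [::Lib 15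
[::13;15;17]; Lib 15 [::7;15;16]; Lib 31 [::10;14;15;13;12]; Lib 27 [::16;7;15;13;9]; Lib 27
[::16;7;15;13;8]; Deg 18 (Lib 13 [::15;18]) (Nbr 18 [::Lib 21 [::10;12;13;15;18;14]; Nbr 9 [::Lib
17 [::13;15;18;9;17]; Lib 17 [::7;15;18;9;16]; Lib 18 [::10;14;9;18;15]; Lib 29 [::2;3;4;5;8;9];
Deg 19 (Lib 3 [::9;19;18]) (Lib 25 [::18;9;19]) (Sel [::18;3;0])]; Sel [::15;11;1]; Deg 19 (Lib 1
[::19;18]) (Lib 24 [::18;19]) (Sel [::15;11;1])]) (Lib 27 [::16;7;15;13;18])]) (Lib 27
[::11;12;13;15;17]); Lib 27 [::11;12;13;9;8]; Lib 30 [::2;3;10;12;13;9;1]; Lib 29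
[::5;6;11;12;13;8]; Deg 17 (Lib 13 [::13;17]) (Deg 18 (Lib 3 [::13;18;17]) (Lib 25 [::17;13;18])
(Sel [::12;0])) (Deg 18 (Lib 13 [::13;18]) (Sel [::12;0]) (Lib 27 [::11;12;13;17;18]))]) (Lib 27
[::1;0;7;15;16]))]) (Lib 27 [::4;3;10;12;14])]); Lib 31 [::6;11;12;8;5]; Lib 29 [::7;0;1;2;9;12];
Deg 13 (Lib 3 [::12;13;11]) (Lib 25 [::11;12;13]) (Nbr 9 [::Lib 26 [::11;12;9;13]; Lib 27
[::1;2;9;12;8]; Lib 27 [::1;2;9;12;7]; Deg 14 (Lib 13 [::9;14]) (Nbr 7 [::Lib 28 [::0;1;2;9;14;7];
Lib 28 [::0;1;2;9;14;7]; Lib 28 [::0;1;2;9;14;7]; Lib 28 [::0;1;2;9;14;7]; Lib 27 [::1;0;7;13;10];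
Lib 27 [::1;0;7;13;8]; Lib 29 [::0;6;11;12;13;7]; Lib 27 [::1;0;7;10;8]; Lib 29 [::3;2;1;0;7;10];
Lib 32 [::0;6;5;8;7;1]; Deg 15 (Lib 13 [::7;15]) (Deg 16 (Lib 3 [::7;16;15]) (Lib 25 [::15;7;16])
(Nbr 15 [::Lib 15 [::7;16;15]; Lib 24 [::14;15]; Nbr 13 [::Lib 30 [::2;3;10;13;12;9;1]; Lib 29
[::5;6;11;12;13;8]; Deg 17 (Lib 3 [::13;17;15]) (Lib 25 [::15;13;17]) (Nbr 14 [::Lib 31
[::9;14;17;13;12]; Nbr 16 [::Lib 29 [::12;9;14;16;17;13]; Lib 29 [::2;9;14;16;10;3]; Lib 30
[::0;6;5;8;16;7;1]; Deg 18 (Lib 3 [::16;18;14]) (Lib 25 [::14;16;18]) (Nbr 8 [::Lib 27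
[::4;5;8;18;17]; Lib 27 [::4;5;8;18;10]; Deg 19 (Lib 13 [::8;19]) (Sel [::12;5]) (Lib 27
[::4;5;8;18;19]); Lib 27 [::4;5;8;17;10]; Sel [::7;5;2]; Lib 31 [::3;4;5;8;10]; Deg 19 (Lib 13
[::8;19]) (Deg 20 (Lib 3 [::8;20;19]) (Lib 25 [::19;8;20]) (Sel [::12;5])) (Sel [::7;5;2])])]; Lib
31 [::9;14;10;3;2]; Nbr 8 [::Lib 29 [::12;9;14;8;17;13]; Lib 30 [::0;6;5;8;16;7;1]; Lib 29
[::2;9;14;8;10;3]; Deg 18 (Lib 3 [::8;18;14]) (Lib 25 [::14;8;18]) (Nbr 16 [::Lib 27
[::15;7;16;18;17]; Lib 27 [::15;7;16;18;10]; Deg 19 (Lib 13 [::16;19]) (Sel [::7;2]) (Lib 27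
[::15;7;16;18;19]); Lib 27 [::15;7;16;17;10]; Lib 31 [::7;15;13;17;16]; Sel [::12;7;5]; Deg 19
(Lib 13 [::16;19]) (Deg 20 (Lib 3 [::16;20;19]) (Lib 25 [::19;16;20]) (Sel [::7;2])) (Sel
[::7;5;2])])]; Deg 18 (Lib 1 [::18;14]) (Lib 24 [::14;18]) (Sel [::9;4;0])])]; Nbr 10 [::Lib 18
[::7;15;10;14;9]; Lib 30 [::2;3;10;13;12;9;1]; Lib 31 [::3;4;5;8;10]; Deg 17 (Lib 3 [::10;17;15])
(Lib 25 [::15;10;17]) (Nbr 14 [::Lib 29 [::2;9;14;17;10;3]; Sel [::9;6;3]; Nbr 8 [::Lib 29
[::8;5;4;3;10;17]; Lib 30 [::0;6;5;8;16;7;1]; Lib 29 [::5;6;11;12;13;8]; Nbr 17 [::Lib 31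
[::7;15;10;17;16]; Sel [::10;9;0]; Deg 18 (Sel [::]) (Lib 18 [::9;14;8;18;17]) (Sel [::10;9;0]);
Lib 27 [::15;10;17;16;13]; Lib 31 [::7;15;10;17;16]; Deg 19 (Lib 13 [::17;19]) (Sel [::10;9;0])
(Lib 27 [::15;10;17;13;19]); Deg 19 (Lib 13 [::17;19]) (Deg 20 (Lib 3 [::17;20;19]) (Lib 25
[::19;17;20]) (Sel [::10;9;0])) (Sel [::10;9;0])]]; Deg 18 (Lib 1 [::18;14]) (Lib 24 [::14;18])
(Sel [::9;4;0])])]; Lib 29 [::0;7;15;8;5;6]; Deg 17 (Lib 1 [::17;15]) (Lib 24 [::15;17]) (Nbr 16
[::Lib 31 [::9;14;16;13;12]; Lib 29 [::2;9;14;16;10;3]; Lib 30 [::0;6;5;8;16;7;1]; Deg 18 (Lib 3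
[::16;18;14]) (Lib 25 [::14;16;18]) (Sel [::11;7;2]); Lib 27 [::15;7;16;13;10]; Lib 27
[::15;7;16;13;8]; Deg 18 (Lib 13 [::16;18]) (Sel [::7;2]) (Lib 27 [::15;7;16;13;18]); Lib 27
[::15;7;16;10;8]; Deg 18 (Lib 13 [::16;18]) (Sel [::11;7;2]) (Lib 27 [::15;7;16;10;18]); Lib 30
[::0;6;5;8;16;7;1]; Deg 18 (Lib 13 [::16;18]) (Deg 19 (Lib 3 [::16;19;18]) (Lib 25 [::18;16;19])
(Sel [::7;2])) (Sel [::11;7;2])])])) (Deg 16 (Lib 13 [::7;16]) (Nbr 14 [::Lib 24 [::14;16]; Nbr 10
[::Lib 30 [::2;3;10;13;12;9;1]; Lib 31 [::3;4;5;8;10]; Deg 17 (Lib 3 [::10;17;16]) (Lib 25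
[::16;10;17]) (Sel [::9;6;3]); Lib 27 [::4;3;10;15;13]; Lib 27 [::4;3;10;15;8]; Lib 29
[::2;9;14;15;10;3]; Lib 27 [::4;3;10;13;8]; Lib 30 [::2;3;10;13;12;9;1]; Lib 31 [::3;4;5;8;10];
Deg 17 (Lib 13 [::10;17]) (Deg 18 (Lib 3 [::10;18;17]) (Lib 25 [::17;10;18]) (Sel [::9;6;3])) (Deg
18 (Lib 13 [::10;18]) (Sel [::9;6;3]) (Lib 27 [::4;3;10;17;18]))]; Lib 31 [::9;14;10;3;2]; Nbr 8
[::Lib 18 [::7;16;8;14;9]; Lib 30 [::0;6;5;8;15;7;1]; Lib 29 [::5;6;11;12;13;8]; Lib 29
[::2;9;14;8;10;3]; Deg 17 (Lib 3 [::8;17;14]) (Lib 25 [::14;8;17]) (Nbr 15 [::Lib 15 [::7;15;16];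
Lib 27 [::16;7;15;17;13]; Lib 27 [::16;7;15;17;10]; Deg 18 (Lib 13 [::15;18]) (Nbr 16 [::Sel
[::7;2]; Sel [::11;7;2]; Deg 19 (Lib 1 [::19;16]) (Lib 24 [::16;19]) (Sel [::7;2])]) (Lib 27
[::16;7;15;17;18]); Lib 15 [::7;15;16]; Lib 15 [::7;15;16]; Lib 15 [::7;15;16]; Lib 27
[::16;7;15;13;10]; Deg 18 (Lib 13 [::15;18]) (Nbr 16 [::Sel [::7;2]; Sel [::7;5;2]; Deg 19 (Lib 1
[::19;16]) (Lib 24 [::16;19]) (Sel [::7;2])]) (Lib 27 [::16;7;15;13;18]); Deg 18 (Lib 13
[::15;18]) (Nbr 10 [::Lib 15 [::10;15;18]; Lib 27 [::4;3;10;15;17]; Lib 27 [::4;3;10;15;13]; Deg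
19 (Lib 13 [::10;19]) (Nbr 19 [::Sel [::10;9;0]; Lib 16 [::7;15;10;19;16]; Sel [::10;5]; Deg 20
(Lib 1 [::20;19]) (Lib 24 [::19;20]) (Sel [::10;5])]) (Lib 27 [::4;3;10;15;19])]) (Lib 27
[::16;7;15;10;18]); Deg 18 (Lib 13 [::15;18]) (Deg 19 (Lib 3 [::15;19;18]) (Lib 25 [::18;15;19])
(Nbr 16 [::Sel [::7;2]; Sel [::7;2]; Sel [::7;5;2]; Deg 20 (Lib 1 [::20;16]) (Lib 24 [::16;20])
(Sel [::7;2])])) (Deg 19 (Lib 13 [::15;19]) (Nbr 16 [::Sel [::7;2]; Sel [::7;2]; Sel [::7;5;2];
Deg 20 (Lib 1 [::20;16]) (Lib 24 [::16;20]) (Sel [::7;2])]) (Lib 27 [::16;7;15;18;19]))])]; Deg 17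
(Lib 1 [::17;14]) (Lib 24 [::14;17]) (Sel [::9;4;0])]) (Lib 27 [::1;0;7;15;16]))]) (Lib 27
[::1;2;9;12;14])]); Lib 30 [::0;6;5;8;12;7;1]; Lib 31 [::6;11;12;8;5]; Lib 31 [::6;11;12;7;0]; Deg
13 (Lib 3 [::12;13;11]) (Lib 25 [::11;12;13]) (Deg 14 (Lib 3 [::12;14;11]) (Lib 25 [::11;12;14])
(Sel [::11;4;1]))]))))]) (Lib 27 [::1;0;6;5;11])])]]]]); ([:: (3, [::1;6]); (2, [::0;2]); (3,
[::1;3]); (3, [::2;4]); (3, [::3;5]); (3, [::4;6]); (3, [::5;0])], Nbr 0 [::Lib 26 [::1;0;6;5];
Lib 15 [::0;2;1]; Nbr 2 [::Lib 26 [::1;2;3;4]; Deg 7 (Lib 3 [::0;7;1]) (Lib 25 [::1;0;7]) (Nbr 6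
[::Deg 8 (Sel [::]) (Lib 17 [::0;6;8;2;1]) (Lib 27 [::1;0;6;5;8]); Lib 26 [::1;0;6;7]; Lib 27
[::1;0;6;5;4]; Deg 8 (Lib 3 [::2;8;1]) (Lib 25 [::1;2;8]) (Deg 9 (Lib 13 [::6;9]) (Nbr 3 [::Lib 28
[::0;1;2;3;9;6]; Lib 26 [::1;2;3;8]; Lib 27 [::1;2;3;4;7]; Lib 27 [::1;2;3;4;5]; Deg 10 (Lib 13
[::3;10]) (Nbr 4 [::Lib 15 [::3;4;10]; Lib 27 [::10;3;4;5;7]; Deg 11 (Lib 13 [::4;11]) (Nbr 11
[::Lib 16 [::4;5;6;9;11]; Lib 31 [::4;11;8;2;3]; Lib 29 [::0;7;11;4;5;6]; Lib 15 [::4;5;11]; Deg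
12 (Lib 1 [::12;11]) (Lib 24 [::11;12]) (Nbr 9 [::Lib 18 [::4;11;12;9;6]; Lib 21 [::3;4;5;6;9;10];
Lib 28 [::0;1;2;8;9;6]; Lib 15 [::5;6;9]; Deg 13 (Lib 1 [::13;9]) (Lib 24 [::9;13]) (Nbr 13 [::Lib
18 [::3;10;13;9;6]; Lib 33 [::2;1;0;6;9;13;8]; Lib 31 [::6;9;13;7;0]; Lib 33 [::4;11;12;13;9;6;5];
Lib 18 [::3;10;13;9;6]; Lib 18 [::3;10;13;9;6]; Lib 18 [::3;10;13;9;6]; Lib 29 [::7;0;1;2;8;13];
Lib 33 [::2;1;0;6;9;13;8]; Lib 31 [::6;9;13;7;0]; Deg 14 (Lib 3 [::13;14;9]) (Lib 25 [::9;13;14])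
(Deg 15 (Lib 3 [::13;15;9]) (Lib 25 [::9;13;15]) (Nbr 5 [::Lib 27 [::9;6;5;4;15]; Lib 27
[::9;6;5;4;14]; Lib 27 [::9;6;5;4;8]; Deg 16 (Lib 13 [::5;16]) (Sel [::9;4;1]) (Lib 27
[::9;6;5;4;16])]))])])]) (Lib 27 [::10;3;4;5;11])]) (Lib 27 [::1;2;3;4;10])]) (Lib 27
[::1;0;6;5;9]))])]]); ([:: (2, [::])], Nbr 0 [::Deg 1 (Lib 1 [::1;0]) (Lib 24 [::0;1]) (Deg 2 (Lib
1 [::2;0]) (Lib 24 [::0;2]) (Nbr 1 [::Lib 15 [::1;2;0]; Deg 3 (Lib 3 [::1;3;0]) (Lib 25 [::0;1;3])
(Deg 4 (Lib 3 [::1;4;0]) (Lib 25 [::0;1;4]) (Nbr 3 [::Lib 26 [::0;1;3;4]; Deg 5 (Lib 13 [::3;5])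
(Deg 6 (Lib 3 [::3;6;5]) (Lib 25 [::5;3;6]) (Nbr 2 [::Lib 31 [::1;0;2;6;3]; Lib 17 [::1;3;5;2;0];
Deg 7 (Lib 3 [::2;7;0]) (Lib 25 [::0;2;7]) (Deg 8 (Lib 3 [::2;8;0]) (Lib 25 [::0;2;8]) (Nbr 5
[::Lib 28 [::1;0;2;8;5;3]; Lib 28 [::1;0;2;7;5;3]; Lib 15 [::3;6;5]; Deg 9 (Lib 1 [::9;5]) (Lib 24
[::5;9]) (Nbr 6 [::Lib 29 [::3;1;0;2;8;6]; Lib 29 [::3;1;0;2;7;6]; Deg 10 (Lib 13 [::6;10]) (Deg
11 (Lib 3 [::6;11;10]) (Lib 25 [::10;6;11]) (Nbr 7 [::Lib 27 [::0;2;7;11;9]; Lib 26 [::0;2;7;8];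
Lib 27 [::0;2;7;11;4]; Lib 34 [::1;0;2;7;11;6;3]; Lib 28 [::3;5;9;7;10;6]; Lib 26 [::0;2;7;8]; Lib
29 [::3;6;10;7;4;1]; Lib 33 [::1;0;2;7;10;6;3]; Lib 26 [::0;2;7;8]; Lib 27 [::0;2;7;9;4]; Lib 33
[::2;0;1;3;5;9;7]; Lib 26 [::0;2;7;8]; Lib 26 [::0;2;7;8]; Lib 31 [::1;0;2;7;4]; Deg 12 (Lib 13
[::7;12]) (Deg 13 (Lib 3 [::7;13;12]) (Lib 25 [::12;7;13]) (Nbr 8 [::Lib 27 [::0;2;8;11;9]; Lib 27
[::0;2;8;11;4]; Lib 34 [::1;0;2;8;11;6;3]; Lib 28 [::3;5;9;8;10;6]; Lib 29 [::3;6;10;8;4;1]; Lib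
33 [::1;0;2;8;10;6;3]; Lib 27 [::0;2;8;9;4]; Lib 33 [::2;0;1;3;5;9;8]; Lib 31 [::1;0;2;8;4]; Deg
14 (Lib 13 [::8;14]) (Deg 15 (Lib 3 [::8;15;14]) (Lib 25 [::14;8;15]) (Sel [::3;2])) (Deg 15 (Lib
13 [::8;15]) (Sel [::3;2]) (Lib 27 [::0;2;8;14;15]))])) (Deg 13 (Lib 13 [::7;13]) (Nbr 8 [::Lib 27
[::0;2;8;11;9]; Lib 27 [::0;2;8;11;4]; Lib 34 [::1;0;2;8;11;6;3]; Lib 28 [::3;5;9;8;10;6]; Lib 29
[::3;6;10;8;4;1]; Lib 33 [::1;0;2;8;10;6;3]; Lib 27 [::0;2;8;9;4]; Lib 33 [::2;0;1;3;5;9;8]; Lib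
31 [::1;0;2;8;4]; Deg 14 (Lib 13 [::8;14]) (Deg 15 (Lib 3 [::8;15;14]) (Lib 25 [::14;8;15]) (Sel
[::3;2])) (Deg 15 (Lib 13 [::8;15]) (Sel [::3;2]) (Lib 27 [::0;2;8;14;15]))]) (Lib 27
[::0;2;7;12;13]))])) (Deg 11 (Lib 13 [::6;11]) (Nbr 7 [::Lib 28 [::3;5;9;7;11;6]; Lib 26
[::0;2;7;8]; Lib 29 [::3;6;11;7;4;1]; Lib 33 [::1;0;2;7;11;6;3]; Lib 27 [::0;2;7;10;9]; Lib 26
[::0;2;7;8]; Lib 27 [::0;2;7;10;4]; Lib 34 [::1;0;2;7;10;6;3]; Lib 26 [::0;2;7;8]; Lib 27
[::0;2;7;9;4]; Lib 33 [::2;0;1;3;5;9;7]; Lib 26 [::0;2;7;8]; Lib 26 [::0;2;7;8]; Lib 31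
[::1;0;2;7;4]; Deg 12 (Lib 13 [::7;12]) (Deg 13 (Lib 3 [::7;13;12]) (Lib 25 [::12;7;13]) (Nbr 8
[::Lib 28 [::3;5;9;8;11;6]; Lib 29 [::3;6;11;8;4;1]; Lib 33 [::1;0;2;8;11;6;3]; Lib 27
[::0;2;8;10;9]; Lib 27 [::0;2;8;10;4]; Lib 34 [::1;0;2;8;10;6;3]; Lib 27 [::0;2;8;9;4]; Lib 33
[::2;0;1;3;5;9;8]; Lib 31 [::1;0;2;8;4]; Deg 14 (Lib 13 [::8;14]) (Deg 15 (Lib 3 [::8;15;14]) (Lib
25 [::14;8;15]) (Sel [::3;2])) (Deg 15 (Lib 13 [::8;15]) (Sel [::3;2]) (Lib 27
[::0;2;8;14;15]))])) (Deg 13 (Lib 13 [::7;13]) (Nbr 8 [::Lib 28 [::3;5;9;8;11;6]; Lib 29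
[::3;6;11;8;4;1]; Lib 33 [::1;0;2;8;11;6;3]; Lib 27 [::0;2;8;10;9]; Lib 27 [::0;2;8;10;4]; Lib 34
[::1;0;2;8;10;6;3]; Lib 27 [::0;2;8;9;4]; Lib 33 [::2;0;1;3;5;9;8]; Lib 31 [::1;0;2;8;4]; Deg 14
(Lib 13 [::8;14]) (Deg 15 (Lib 3 [::8;15;14]) (Lib 25 [::14;8;15]) (Sel [::3;2])) (Deg 15 (Lib 13
[::8;15]) (Sel [::3;2]) (Lib 27 [::0;2;8;14;15]))]) (Lib 27 [::0;2;7;12;13]))]) (Lib 27
[::5;3;6;10;11]))])]))])) (Deg 6 (Lib 13 [::3;6]) (Nbr 2 [::Lib 17 [::1;3;6;2;0]; Lib 31
[::1;0;2;5;3]; Deg 7 (Lib 3 [::2;7;0]) (Lib 25 [::0;2;7]) (Deg 8 (Lib 3 [::2;8;0]) (Lib 25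
[::0;2;8]) (Nbr 5 [::Lib 15 [::3;5;6]; Lib 29 [::3;1;0;2;8;5]; Lib 15 [::3;5;6]; Lib 29
[::3;1;0;2;7;5]; Lib 15 [::3;5;6]; Deg 9 (Lib 13 [::5;9]) (Deg 10 (Lib 3 [::5;10;9]) (Lib 25
[::9;5;10]) (Nbr 6 [::Lib 28 [::1;0;2;8;6;3]; Lib 28 [::1;0;2;7;6;3]; Deg 11 (Lib 1 [::11;6]) (Lib
24 [::6;11]) (Nbr 7 [::Lib 27 [::0;2;7;11;10]; Lib 28 [::3;6;11;7;9;5]; Lib 26 [::0;2;7;8]; Lib 27
[::0;2;7;11;4]; Lib 33 [::2;0;1;3;6;11;7]; Lib 26 [::0;2;7;8]; Lib 27 [::0;2;7;10;4]; Lib 34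
[::1;0;2;7;10;5;3]; Lib 26 [::0;2;7;8]; Lib 29 [::3;5;9;7;4;1]; Lib 33 [::1;0;2;7;9;5;3]; Lib 26
[::0;2;7;8]; Lib 26 [::0;2;7;8]; Lib 31 [::1;0;2;7;4]; Deg 12 (Lib 13 [::7;12]) (Deg 13 (Lib 3
[::7;13;12]) (Lib 25 [::12;7;13]) (Nbr 8 [::Lib 27 [::0;2;8;11;10]; Lib 28 [::3;6;11;8;9;5]; Lib
27 [::0;2;8;11;4]; Lib 33 [::2;0;1;3;6;11;8]; Lib 27 [::0;2;8;10;4]; Lib 34 [::1;0;2;8;10;5;3];
Lib 29 [::3;5;9;8;4;1]; Lib 33 [::1;0;2;8;9;5;3]; Lib 31 [::1;0;2;8;4]; Deg 14 (Lib 13 [::8;14])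
(Deg 15 (Lib 3 [::8;15;14]) (Lib 25 [::14;8;15]) (Sel [::3;2])) (Deg 15 (Lib 13 [::8;15]) (Sel
[::3;2]) (Lib 27 [::0;2;8;14;15]))])) (Deg 13 (Lib 13 [::7;13]) (Nbr 8 [::Lib 27 [::0;2;8;11;10];
Lib 28 [::3;6;11;8;9;5]; Lib 27 [::0;2;8;11;4]; Lib 33 [::2;0;1;3;6;11;8]; Lib 27 [::0;2;8;10;4];
Lib 34 [::1;0;2;8;10;5;3]; Lib 29 [::3;5;9;8;4;1]; Lib 33 [::1;0;2;8;9;5;3]; Lib 31 [::1;0;2;8;4];
Deg 14 (Lib 13 [::8;14]) (Deg 15 (Lib 3 [::8;15;14]) (Lib 25 [::14;8;15]) (Sel [::3;2])) (Deg 15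
(Lib 13 [::8;15]) (Sel [::3;2]) (Lib 27 [::0;2;8;14;15]))]) (Lib 27 [::0;2;7;12;13]))])])) (Deg 10
(Lib 13 [::5;10]) (Nbr 6 [::Lib 28 [::1;0;2;8;6;3]; Lib 28 [::1;0;2;7;6;3]; Deg 11 (Lib 1
[::11;6]) (Lib 24 [::6;11]) (Nbr 7 [::Lib 28 [::3;6;11;7;10;5]; Lib 27 [::0;2;7;11;9]; Lib 26
[::0;2;7;8]; Lib 27 [::0;2;7;11;4]; Lib 33 [::2;0;1;3;6;11;7]; Lib 26 [::0;2;7;8]; Lib 29
[::3;5;10;7;4;1]; Lib 33 [::1;0;2;7;10;5;3]; Lib 26 [::0;2;7;8]; Lib 27 [::0;2;7;9;4]; Lib 34
[::1;0;2;7;9;5;3]; Lib 26 [::0;2;7;8]; Lib 26 [::0;2;7;8]; Lib 31 [::1;0;2;7;4]; Deg 12 (Lib 13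
[::7;12]) (Deg 13 (Lib 3 [::7;13;12]) (Lib 25 [::12;7;13]) (Nbr 8 [::Lib 28 [::3;6;11;8;10;5]; Lib
27 [::0;2;8;11;9]; Lib 27 [::0;2;8;11;4]; Lib 33 [::2;0;1;3;6;11;8]; Lib 29 [::3;5;10;8;4;1]; Lib
33 [::1;0;2;8;10;5;3]; Lib 27 [::0;2;8;9;4]; Lib 34 [::1;0;2;8;9;5;3]; Lib 31 [::1;0;2;8;4]; Deg
14 (Lib 13 [::8;14]) (Deg 15 (Lib 3 [::8;15;14]) (Lib 25 [::14;8;15]) (Sel [::3;2])) (Deg 15 (Lib
13 [::8;15]) (Sel [::3;2]) (Lib 27 [::0;2;8;14;15]))])) (Deg 13 (Lib 13 [::7;13]) (Nbr 8 [::Lib 28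
[::3;6;11;8;10;5]; Lib 27 [::0;2;8;11;9]; Lib 27 [::0;2;8;11;4]; Lib 33 [::2;0;1;3;6;11;8]; Lib 29
[::3;5;10;8;4;1]; Lib 33 [::1;0;2;8;10;5;3]; Lib 27 [::0;2;8;9;4]; Lib 34 [::1;0;2;8;9;5;3]; Lib
31 [::1;0;2;8;4]; Deg 14 (Lib 13 [::8;14]) (Deg 15 (Lib 3 [::8;15;14]) (Lib 25 [::14;8;15]) (Sel
[::3;2])) (Deg 15 (Lib 13 [::8;15]) (Sel [::3;2]) (Lib 27 [::0;2;8;14;15]))]) (Lib 27
[::0;2;7;12;13]))])]) (Lib 27 [::6;3;5;9;10]))]))]) (Lib 27 [::0;1;3;5;6]))]))]))]); ([:: (3,
[::])], Nbr 0 [::Deg 1 (Lib 13 [::0;1]) (Lib 35 [::1]) (Deg 2 (Lib 13 [::0;2]) (Lib 35 [::2]) (Deg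
3 (Lib 13 [::0;3]) (Lib 35 [::3]) (Nbr 1 [::Deg 4 (Lib 4 [::1;4;0;3]) (Lib 26 [::4;1;0;3]) (Nbr 3
[::Deg 5 (Lib 4 [::3;5;0;1]) (Lib 26 [::5;3;0;1]) (Nbr 2 [::Deg 6 (Lib 13 [::2;6]) (Lib 27
[::6;2;0;1;3]) (Deg 7 (Lib 13 [::2;7]) (Lib 27 [::7;2;0;1;3]) (Sel [::0]))])]); Deg 4 (Lib 4
[::1;4;0;2]) (Lib 26 [::4;1;0;2]) (Nbr 2 [::Deg 5 (Lib 4 [::2;5;0;1]) (Lib 26 [::5;2;0;1]) (Nbr 3
[::Deg 6 (Lib 13 [::3;6]) (Lib 27 [::6;3;0;1;2]) (Deg 7 (Lib 13 [::3;7]) (Lib 27 [::7;3;0;1;2])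
(Sel [::0]))])]); Deg 4 (Lib 13 [::1;4]) (Lib 27 [::4;1;0;2;3]) (Deg 5 (Lib 13 [::1;5]) (Lib 27
[::5;1;0;2;3]) (Nbr 2 [::Deg 6 (Lib 4 [::2;6;0;3]) (Lib 26 [::6;2;0;3]) (Nbr 3 [::Deg 7 (Lib 4
[::3;7;0;2]) (Lib 26 [::7;3;0;2]) (Sel [::0])]); Deg 6 (Lib 13 [::2;6]) (Lib 27 [::6;2;0;1;3])
(Deg 7 (Lib 13 [::2;7]) (Lib 27 [::7;2;0;1;3]) (Nbr 3 [::Deg 8 (Lib 13 [::3;8]) (Lib 27
[::8;3;0;1;2]) (Deg 9 (Lib 13 [::3;9]) (Lib 27 [::9;3;0;1;2]) (Sel [::0]))]))]))])))])].

(** [leaf_path] and [pentagon] are refuted by rewiring instead of a tree. Each needs patterns of the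
    chain before it and serves the chains after it, which is why there are three chains. *)
Definition lib_leaf : seq pattern := rcons (unzip1 certs_leaf) leaf_path.
Definition lib_pentagon : seq pattern := rcons (lib_leaf ++ unzip1 certs_pentagon) pentagon.

Lemma certs_leaf_ok : refutes_chain [::] certs_leaf.
Proof. by vm_compute. Qed.

Lemma certs_pentagon_ok : refutes_chain lib_leaf certs_pentagon.
Proof. by vm_compute. Qed.

Lemma certs_main_ok : refutes_chain lib_pentagon certs_main.
Proof. by vm_compute. Qed.

(** The one-vertex patterns of degree 1, 2 and 3 are themselves entries of [certs_main]. *)
Lemma vertex_refuted (T : finType) (e : rel T) (X : {set T}) d : minimal e X ->
  0 < d <= 3 -> refuted e X [:: (d, [::])].
Proof.
move=> min d3.
have [wf1 ref1] := refutes_chainP min (lib := [::]) isT (fun p => ltac:(by [])) certs_leaf_ok.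
have wf1' : all well_formed lib_leaf by rewrite all_rcons wf1.
have ref1' : {in lib_leaf, forall p, refuted e X p}.
  move=> p; rewrite mem_rcons inE => /predU1P[->|/ref1//].
  by apply: (leaf_path_refuted min); apply: ref1.
have [wf2 ref2] := refutes_chainP min wf1' ref1' certs_pentagon_ok.
have wf2' : all well_formed lib_pentagon by rewrite all_rcons wf2.
have ref2' : {in lib_pentagon, forall p, refuted e X p}.
  move=> p; rewrite mem_rcons inE => /predU1P[->|/ref2//].
  by apply: (pentagon_refuted min); apply: ref2.
have [_ ref3] := refutes_chainP min wf2' ref2' certs_main_ok.
by apply: ref3; case: d d3 => [|[|[|[|d]]]].
Qed.

(** * The weighted bound and its cubic case *)

Lemma light_ids_exists (T : finType) (e : rel T) (X : {set T}) :
  admissible e X -> light_ids e X.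
Proof.
have [n] := ubnP #|X|; elim: n e X => // n IHn e X leXn adm.
apply: contraT => bad; have min : minimal e X.
  by split=> // e' Y ltYX; apply: IHn; apply: leq_trans ltYX _.
have [v vX] := set0Pn _ (minimal_neq0 min).
have d3 : 0 < deg e X v <= 3 by rewrite (minimal_deg_gt0 min) // (adm_deg adm).
(* The pattern has a single vertex and no edge, so a constant map is an occurrence. *)
case: (vertex_refuted min d3 (f := fun=> v)); split=> [[|i] [|j]|i|[|i]|[|i] j|[|i]] //=;
  by rewrite /dg /ad /= nth_nil.
Qed.

Local Open Scope ring_scope.

Theorem theorem1p5 (G : sgraph) (hcubic : cubic G)
    (hC4 : ~ has_cycle_of_length G 4) :
  (indep_dom_num G)%:R <= 5%:R / 14%:R * #|G|%:R :> rat.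
Proof.
have degG v : deg (@adj G) [set: G] v = 3%N.
  by rewrite -(hcubic v) /degree /deg; congr #|pred_of_set _|; apply/setP => u; rewrite !inE.
have adm : admissible (@adj G) [set: G].
  split; [exact: adj_sym | exact: adj_irrefl | by move=> v _; rewrite degG |].
  move=> a b c d _ _ _ _ ab bc cd da ac bd; apply: hC4; split=> //.
  exists [:: a; b; c; d] => //; rewrite /ucycle /= ab bc cd da /= !inE !negb_or ac bd.
  (* Opposite corners differ by hypothesis, consecutive ones because they are adjacent; so the four
     vertices form a cycle without repetition. *)
  have neq u v : adj u v -> u != v by apply: contraTneq => ->; rewrite adj_irrefl.
  by rewrite !neq // adj_sym.
have /existsP[I /and4P[_ /forall_inP indI /forall_inP domI wI]] := light_ids_exists adm.
have idI : independent_dominating I.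
  apply/andP; split; apply/forallP => v; apply/implyP; first exact: indI.
  by move=> vI; apply: domI; rewrite !inE vI.
have leI : (indep_dom_num G <= #|I|)%N.
  rewrite /indep_dom_num; case: ex_minnP => m _; apply.
  by apply/existsP; exists I; rewrite idI /=.
have wG : weight (@adj G) [set: G] = (5 * #|G|)%N.
  rewrite /weight (eq_bigr (fun=> 5%N)) => [|v _]; last by rewrite degG.
  by rewrite sum_nat_const cardsT mulnC.
have bound : (14 * indep_dom_num G <= 5 * #|G|)%N.
  by rewrite -wG (leq_trans _ wI) // leq_mul2l.
rewrite mulrAC ler_pdivlMr ?ltr0n // mulrC -!natrM ler_nat.
exact: bound.
Qed.
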